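(* Let $\beta\in\mathbb{C}$ with $\beta\notin\mathbb{Z}$ and let $\phi(e^{i\theta})=t_\beta(e^{i\theta})$. Then, as $n\to\infty$, $$\det M_n(\phi)\sim n^{-3\beta^2/2-\beta/2}\,(2\pi)^{\beta/2}\,2^{3\beta^2/2}\,G(1/2)^{-1}\,G(1/2-\beta)\,G(1-\beta)\,G(1+\beta).$$ Moreover, $\det M_n(\phi)=0$ if and only if $\beta\in\{1/2,3/2,\dots,n-1/2\}$.
   Context: $\phi_k=\frac1{2\pi}\int_0^{2\pi}\phi(e^{i\theta})e^{-ik\theta}d\theta$ is the $k$-th Fourier coefficient, and $M_n(\phi)=(\phi_{j-k}+\phi_{j+k+1})_{j,k=0}^{n-1}$. For $\beta\in\mathbb{C}$, $t_\beta(e^{i\theta})=\exp(i\beta(\theta-\pi))$ for $0<\theta<2\pi$. $G(\cdot)$ is the Barnes G-function, $G(1+z)=(2\pi)^{z/2}e^{-(z+1)z/2-\gamma_E z^2/2}\prod_{k=1}^\infty\left((1+z/k)^k e^{-z+z^2/(2k)}\right)$, with $\gamma_E$ Euler's constant. $a_n\sim c_n$ means $a_n=c_n(1+o(1))$ as $n\to\infty$ (so if $c_n=0$ for all $n$, then $a_n=0$ for all large $n$). *)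

(* Defs.v *)
From HB Require Import structures.
From mathcomp Require Import all_boot all_order all_algebra.
From mathcomp Require Import all_classical all_reals all_analysis.
From mathcomp Require Import complex.

Set Implicit Arguments.
Unset Strict Implicit.
Unset Printing Implicit Defensive.

Import Order.TTheory GRing.Theory Num.Theory.
Import numFieldNormedType.Exports.

Local Open Scope classical_set_scope.
Local Open Scope ring_scope.
Local Open Scope complex_scope.

(* The topology of the complex numbers R[i] is the one given by the modulus. *)
HB.instance Definition _ (R : rcfType) := NormedModule.copy R[i] R[i]^o.

Definition expC {R : realType} (z : R[i]) : R[i] :=
  (expR (complex.Re z))%:C * (cos (complex.Im z) +i* sin (complex.Im z)).

(* a ^ w = exp (w ln a); meaningful only for a > 0. *)
Definition cpow {R : realType} (a : R) (w : R[i]) : R[i] :=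
  expC (w * (ln a)%:C).

Definition integralC {R : realType} (D : set R) (f : R -> R[i]) : R[i] :=
  (\int[lebesgue_measure]_(x in D) complex.Re (f x))
  +i* (\int[lebesgue_measure]_(x in D) complex.Im (f x)).

(* Symbols are functions phi : R[i] -> R[i], of which only the values on the
   unit circle matter. *)
Definition fourier_coef {R : realType} (phi : R[i] -> R[i]) (k : int) : R[i] :=
  ((2 * pi)^-1)%:C *
  integralC `[0, 2 * pi] (fun theta =>
    phi (expC ('i * theta%:C)) * expC (- ('i * k%:~R * theta%:C))).

Definition toeplitz_hankel {R : realType} (n : nat) (phi : R[i] -> R[i]) :
    'M[R[i]]_n :=
  \matrix_(j < n, k < n)
    (fourier_coef phi (j%:Z - k%:Z) + fourier_coef phi (j%:Z + k%:Z + 1)).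

(* phi = t_beta on the unit circle with the point 1 removed, where its
   value is left unspecified. *)
Definition is_t_symbol {R : realType} (beta : R[i]) (phi : R[i] -> R[i]) : Prop :=
  forall theta : R, 0 < theta < 2 * pi ->
    phi (expC ('i * theta%:C)) = expC ('i * beta * (theta - pi)%:C).

Definition euler_gamma {R : realType} : R :=
  limn (fun n : nat => (\sum_(1 <= k < n.+1) k%:R^-1) - ln n%:R : R).

(* barnesG1 z is G(1 + z). *)
Definition barnesG1 {R : realType} (z : R[i]) : R[i] :=
  cpow (2 * pi) (z / 2)
  * expC (- ((z + 1) * z / 2) - euler_gamma%:C * z ^+ 2 / 2)
  * limn (fun N : nat => \prod_(1 <= k < N.+1)
      ((1 + z / k%:R) ^+ k * expC (- z + z ^+ 2 / (2 * k%:R))) : R[i]).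

Definition barnesG {R : realType} (w : R[i]) : R[i] := barnesG1 (w - 1).

(* a n = c n (1 + o(1)); c may vanish, and then so does a for large n. *)
Definition asymp_equiv {R : realType} (a c : nat -> R[i]) : Prop :=
  exists2 e : nat -> R[i], e n @[n --> \oo] --> (0 : R[i]) &
    \forall n \near \oo, a n = c n * (1 + e n).

(* Main.v *)
Require Import Defs.
From mathcomp Require Import all_boot all_order all_algebra.
From mathcomp Require Import all_classical all_reals all_analysis measurable_realfun.
From mathcomp Require Import complex.
From mathcomp Require Import ring lra zify.

Set Implicit Arguments.
Unset Strict Implicit.
Unset Printing Implicit Defensive.

Import Order.TTheory GRing.Theory Num.Theory.
Import numFieldNormedType.Exports.
Import Normc.

Local Open Scope classical_set_scope.
Local Open Scope ring_scope.
Local Open Scope complex_scope.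

(** The Fourier coefficients of the symbol are [s / (beta - k)] with
    [s = sin (pi beta) / pi], an elementary integral. With
    [x = beta - j - 1 / 2] and [y = k + 1 / 2] the entries of the matrix are
    [s (1 / (x + y) + 1 / (x - y)) = 2 s x / (x ^ 2 - y ^ 2)], a Cauchy matrix
    in the squares up to a scaling of its rows, so the determinant is an
    explicit product ([det_cauchy], [det_toeplitz_hankel]). Since [beta] is not
    an integer, the only factors that can vanish are those of the form
    [2 beta - m] with [m] odd, which gives the zeros ([prod_det_ratio_eq0]).

    For the asymptotics put [L m = 1 - 2 beta / m] and
    [s_n = prod_(k <= n) (1 - beta ^ 2 / k ^ 2)], whose limit is [s / beta] by
    Euler's product for the sine ([cvg_sine_prod]). The ratio of the
    determinants of orders [r + 1] and [r] is
    [(s / beta) / s_r * L (2 r + 1) / L (4 r + 2)] times the product of the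
    [L m / L (2 m) ^ 2] over [r < m <= 2 r]. Multiplying these ratios and
    collecting equal factors ([prod_det_ratioE]), the determinant of order [n]
    becomes
    [((s / beta) / s_n) ^ n
      * prod_(k <= n) ((1 - beta ^ 2 / k ^ 2) * L (2 k - 1)) ^ k / V_n],
    where [V_n] only involves factors [L m] and [L (2 m)] with [n < m <= 2 n].
    - The first factor tends to [exp (- beta ^ 2)] ([cvg_sine_tail]).
    - [(1 - beta ^ 2 / k ^ 2) L (2 k - 1)] is the product of
      [1 + beta / k], [1 - beta / k] and [1 - (1 / 2 + beta) / k] divided by
      [1 - 1 / (2 k)]; hence the second factor is a quotient of partial
      products of the Barnes function at [1 + beta], [1 - beta],
      [1 / 2 - beta] and [1 / 2], up to an exponential in [n] and in the
      harmonic number of [n] ([barnes_ratioE]).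
    - All factors of [V_n] are close to 1, so each factor [1 + w] may be replaced
      by [exp (w - w ^ 2 / 2)] ([cvg_window_prod]); the sums that occur in the
      exponent are Riemann sums, which produce [ln 2].
    The exponentials in [n] cancel and the harmonic number contributes the
    power of [n] and Euler's constant.

    The limits of products are obtained without complex logarithms, from the
    fact that [(1 + w) exp (- w + w ^ 2 / 2)] is [1 + O(w ^ 3)] ([expC_approx2]), together
    with the inequality bounding a product minus 1 by
    [exp (sum of the deviations) - 1] ([normc_prod_sub1]). *)

(** * Modulus, exponential and real-variable calculus of complex numbers *)

Section ComplexModulus.
Variable R : realType.
Implicit Types (z w : R[i]) (x : R).

Lemma normr_normc z : `|z| = (normc z)%:C.
Proof. by []. Qed.

Lemma normc_ge0 z : 0 <= normc z.
Proof. by case: z => a b; exact: sqrtr_ge0. Qed.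

Lemma normc_gt0 z : (0 < normc z) = (z != 0).
Proof. by rewrite -ltcR -normr_normc normr_gt0. Qed.

Lemma normcR x : normc x%:C = `|x|.
Proof. by rewrite /normc /= expr0n addr0 sqrtr_sqr. Qed.

Lemma normcn n : normc (n%:R : R[i]) = n%:R.
Proof. by rewrite -(rmorph_nat (real_complex R)) normcR normr_nat. Qed.

Lemma normcX z n : normc (z ^+ n) = normc z ^+ n.
Proof.
by elim: n => [|n IH]; rewrite ?expr0 ?normc1 // !exprS normcM IH.
Qed.

Lemma normcBC z w : normc (z - w) = normc (w - z).
Proof. by rewrite -(normcN (z - w)) opprB. Qed.

Lemma ler_normcD z w : normc (z + w) <= normc z + normc w.
Proof. exact: le_normcD. Qed.

Lemma ler_normcB z w : normc (z - w) <= normc z + normc w.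
Proof. by rewrite -(normcN w) ler_normcD. Qed.

Lemma lerB_normc z w : normc z - normc w <= normc (z - w).
Proof. by rewrite lerBlDr -{1}(subrK w z) ler_normcD. Qed.

Lemma normc_Re z : `|complex.Re z| <= normc z.
Proof. by rewrite -lecR -normr_normc normc_ge_Re. Qed.

Lemma normc_Im z : `|complex.Im z| <= normc z.
Proof.
have := normc_Re (z * 'i); rewrite ReiNIm normrN normcM.
by rewrite [normc 'i]/normc expr0n expr1n add0r sqrtr1 mulr1.
Qed.

Lemma normc_le_ReIm z : normc z <= `|complex.Re z| + `|complex.Im z|.
Proof.
rewrite {1}[z]complexE (le_trans (ler_normcD _ _)) // normcM !normcR.
by rewrite [normc 'i]/normc expr0n expr1n add0r sqrtr1 mul1r.
Qed.

Lemma ReD z w : complex.Re (z + w) = complex.Re z + complex.Re w.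
Proof. by case: z w => [a b] [c d]. Qed.

Lemma ImD z w : complex.Im (z + w) = complex.Im z + complex.Im w.
Proof. by case: z w => [a b] [c d]. Qed.

Lemma ReN z : complex.Re (- z) = - complex.Re z.
Proof. by case: z. Qed.

Lemma ImN z : complex.Im (- z) = - complex.Im z.
Proof. by case: z. Qed.

Lemma ReM z w :
  complex.Re (z * w) = complex.Re z * complex.Re w - complex.Im z * complex.Im w.
Proof. by case: z w => [a b] [c d]. Qed.

Lemma ImM z w :
  complex.Im (z * w) = complex.Re z * complex.Im w + complex.Im z * complex.Re w.
Proof. by case: z w => [a b] [c d]. Qed.

Lemma complex_ext z w :
  complex.Re z = complex.Re w -> complex.Im z = complex.Im w -> z = w.
Proof. by case: z w => [a b] [c d] /= -> ->. Qed.

End ComplexModulus.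

Section ComplexExponential.
Variable R : realType.
Implicit Types (z w : R[i]) (x : R).

Lemma Re_expC z :
  complex.Re (expC z) = expR (complex.Re z) * cos (complex.Im z).
Proof. by rewrite /expC ReM /= mul0r subr0. Qed.

Lemma Im_expC z :
  complex.Im (expC z) = expR (complex.Re z) * sin (complex.Im z).
Proof. by rewrite /expC ImM /= mul0r addr0. Qed.

Lemma expC0 : expC 0 = 1 :> R[i].
Proof. by apply: complex_ext; rewrite ?Re_expC ?Im_expC /= expR0 ?cos0 ?sin0 mul1r. Qed.

Lemma expCD z w : expC (z + w) = expC z * expC w.
Proof.
apply: complex_ext.
  by rewrite Re_expC (ReM (expC z)) !Re_expC !Im_expC ReD ImD expRD cosD; ring.
by rewrite Im_expC (ImM (expC z)) !Re_expC !Im_expC ReD ImD expRD sinD; ring.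
Qed.

Lemma expCNM z : expC (- z) * expC z = 1.
Proof. by rewrite -expCD addNr expC0. Qed.

Lemma expC_neq0 z : expC z != 0.
Proof.
by apply/eqP => z0; have := expCNM z; rewrite z0 mulr0 => /esym/eqP; rewrite oner_eq0.
Qed.

Lemma expCN z : expC (- z) = (expC z)^-1.
Proof. by apply: (mulIf (expC_neq0 z)); rewrite expCNM mulVf ?expC_neq0. Qed.

Lemma expC_sum (I : Type) (r : seq I) (F : I -> R[i]) :
  expC (\sum_(i <- r) F i) = \prod_(i <- r) expC (F i).
Proof. exact: (big_morph _ expCD expC0). Qed.

Lemma expCMn z n : expC (n%:R * z) = expC z ^+ n.
Proof.
elim: n => [|n IH]; first by rewrite mul0r expC0.
by rewrite exprS -IH -expCD -[n.+1]add1n natrD mulrDl mul1r.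
Qed.

Lemma expC_imag x : expC ('i * x%:C) = cos x +i* sin x :> R[i].
Proof.
have -> : 'i * x%:C = 0 +i* x.
  by apply: complex_ext => /=; rewrite ?(mul0r, mul1r, mulr0, addr0, add0r, oppr0).
by rewrite /expC /= expR0 mul1r.
Qed.

Lemma normc_expC z : normc (expC z) = expR (complex.Re z).
Proof.
rewrite /expC normcM normcR ger0_norm ?expR_ge0 //.
by rewrite /normc cos2Dsin2 sqrtr1 mulr1.
Qed.

Lemma normc_expC_le z : normc (expC z) <= expR (normc z).
Proof. by rewrite normc_expC ler_expR (le_trans (ler_norm _)) // normc_Re. Qed.

End ComplexExponential.

Section ComplexDerivative.
Variable R : realType.
Implicit Types (f g : R -> R[i]) (x : R).

(** Derivatives of complex-valued functions of a real variable are taken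
    componentwise: the complex numbers carry their own normed structure, over
    themselves and not over the reals. *)
Definition is_deriveC f x (df : R[i]) :=
  is_derive x 1 (fun t => complex.Re (f t)) (complex.Re df) /\
  is_derive x 1 (fun t => complex.Im (f t)) (complex.Im df).

Lemma is_deriveC_eq f x df df' : is_deriveC f x df -> df = df' -> is_deriveC f x df'.
Proof. by move=> ? <-. Qed.

Lemma is_deriveC_cst (c : R[i]) x : is_deriveC (fun=> c) x 0.
Proof. by split; exact: is_derive_cst. Qed.

Lemma is_deriveC_id x : is_deriveC (fun t => t%:C) x 1.
Proof. by split; [exact: is_derive_id|exact: is_derive_cst]. Qed.

Lemma is_deriveCD f g x df dg :
  is_deriveC f x df -> is_deriveC g x dg ->
  is_deriveC (fun t => f t + g t) x (df + dg).
Proof.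
move=> [f1 f2] [g1 g2]; split; rewrite ?ReD ?ImD.
  under eq_fun do rewrite ReD.
  exact: is_deriveD.
under eq_fun do rewrite ImD.
exact: is_deriveD.
Qed.

Lemma is_deriveCM f g x df dg :
  is_deriveC f x df -> is_deriveC g x dg ->
  is_deriveC (fun t => f t * g t) x (df * g x + f x * dg).
Proof.
move=> [f1 f2] [g1 g2]; split.
  under eq_fun do rewrite ReM.
  apply: (is_derive_eq (is_deriveB (is_deriveM f1 g1) (is_deriveM f2 g2))).
  by rewrite ReD !ReM /GRing.scale /=; ring.
under eq_fun do rewrite ImM.
apply: (is_derive_eq (is_deriveD (is_deriveM f1 g2) (is_deriveM f2 g1))).
by rewrite ImD !ImM /GRing.scale /=; ring.
Qed.

Lemma is_deriveC_expC f x df :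
  is_deriveC f x df -> is_deriveC (fun t => expC (f t)) x (df * expC (f x)).
Proof.
move=> [f1 f2].
have e1 := is_derive1_comp (is_derive_expR (complex.Re (f x))) f1.
split.
  under eq_fun do rewrite Re_expC.
  have c1 := is_derive1_comp (is_derive_cos (complex.Im (f x))) f2.
  apply: (is_derive_eq (is_deriveM e1 c1)).
  by rewrite (ReM df) Re_expC Im_expC /GRing.scale /=; ring.
under eq_fun do rewrite Im_expC.
have s1 := is_derive1_comp (is_derive_sin (complex.Im (f x))) f2.
apply: (is_derive_eq (is_deriveM e1 s1)).
by rewrite (ImM df) Re_expC Im_expC /GRing.scale /=; ring.
Qed.

Lemma is_derive1_bound (f df : R -> R) (K : R) :
  (forall x : R, is_derive x (1 : R) f (df x)) ->
  (forall x, 0 <= x <= 1 -> `|df x| <= K) -> `|f 1 - f 0| <= K.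
Proof.
move=> fd dfK; have [|c c01 ->] := MVT_segment ler01 (fun x _ => fd x).
  apply: derivable_within_continuous => x _; exact: (@ex_derive _ _ _ _ _ _ _ (fd x)).
by rewrite subr0 mulr1 dfK // -in_itv.
Qed.

(** The mean value theorem, applied to each component, whence the factor 2. *)
Lemma is_deriveC_bound f (df : R -> R[i]) (K : R) :
  (forall x, is_deriveC f x (df x)) ->
  (forall x, 0 <= x <= 1 -> normc (df x) <= K) -> normc (f 1 - f 0) <= 2 * K.
Proof.
move=> fd dfK; rewrite (le_trans (normc_le_ReIm _)) // ReD ImD ReN ImN.
rewrite mulr_natl mulr2n lerD //.
  apply: (is_derive1_bound (fun x => (fd x).1)) => x x01.
  by rewrite (le_trans (normc_Re _)) ?dfK.
apply: (is_derive1_bound (fun x => (fd x).2)) => x x01.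
by rewrite (le_trans (normc_Im _)) ?dfK.
Qed.

End ComplexDerivative.

(** * Complex sequences and products of factors close to 1 *)

Section ComplexConvergence.
Variable R : realType.
Implicit Types (u v : nat -> R[i]) (l z w : R[i]).

Lemma cvgC_normP u l : (u n @[n --> \oo] --> l) <->
  (forall e : R, 0 < e -> \forall n \near \oo, normc (u n - l) < e).
Proof.
split=> [/cvgrPdist_lt ul e e0|ul].
  have := ul e%:C; rewrite ltcR => /(_ e0).
  by apply: filterS => n; rewrite distrC normr_normc ltcR.
apply/cvgrPdist_lt => e e0.
have eE : e = (complex.Re e)%:C by rewrite RRe_real // ger0_real // ltW.
have /ul : 0 < complex.Re e by rewrite -ltcR -eE.
by apply: filterS => n; rewrite distrC eE normr_normc ltcR.
Qed.

Lemma cvgC_squeeze u l (d : nat -> R) :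
  (\forall n \near \oo, normc (u n - l) <= d n) -> d n @[n --> \oo] --> 0 ->
  u n @[n --> \oo] --> l.
Proof.
move=> ud /cvgrPdist_lt d0; apply/cvgC_normP => e /d0.
apply: filterS2 ud => n ud; rewrite sub0r normrN => /(le_lt_trans (ler_norm _)).
exact: le_lt_trans.
Qed.

Lemma cvgC_mul u v (a b c : R[i]) : u n @[n --> \oo] --> a ->
  v n @[n --> \oo] --> b -> a * b = c -> u n * v n @[n --> \oo] --> c.
Proof. by move=> ua vb <-; exact: (cvgM ua vb). Qed.

Lemma cvgC_sub u v (a b : R[i]) : u n @[n --> \oo] --> a ->
  v n @[n --> \oo] --> b -> u n - v n @[n --> \oo] --> a - b.
Proof. by move=> ua vb; exact: (cvgB ua vb). Qed.

Lemma cvgC_inv u (a : R[i]) : u n @[n --> \oo] --> a -> a != 0 ->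
  (u n)^-1 @[n --> \oo] --> a^-1.
Proof. by move=> ua a0; exact: (cvgV a0 ua). Qed.

Lemma cvgC_cst (c : R[i]) : c @[n --> \oo] --> c.
Proof. exact: cvg_cst. Qed.

Lemma cvgC_unique u (a b : R[i]) :
  u n @[n --> \oo] --> a -> u n @[n --> \oo] --> b -> a = b.
Proof. by move=> ua ub; exact: (cvg_unique _ ua ub). Qed.

Lemma cvgC_normc u l : u n @[n --> \oo] --> l ->
  normc (u n) @[n --> \oo] --> normc l.
Proof.
move=> /cvgC_normP ul; apply/cvgrPdist_lt => e /ul; apply: filterS => n.
apply: le_lt_trans; have := lerB_normc (u n) l; have := lerB_normc l (u n).
by rewrite normcBC ler_norml => *; apply/andP; split; lra.
Qed.

Lemma cvgC_ReIm u (a b : R) :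
  complex.Re (u n) @[n --> \oo] --> a -> complex.Im (u n) @[n --> \oo] --> b ->
  u n @[n --> \oo] --> a +i* b.
Proof.
move=> /cvgrPdist_lt ua /cvgrPdist_lt ub; apply/cvgC_normP => e e0.
have e2 : 0 < e / 2 by lra.
move: (ua _ e2) (ub _ e2) => {}ua {}ub.
apply: filterS2 ua ub => n /= ua ub.
rewrite (le_lt_trans (normc_le_ReIm _)) // ReD ImD ReN ImN /=.
rewrite distrC (distrC _ b); lra.
Qed.

Lemma cvgC_real (x : nat -> R) (a : R) :
  x n @[n --> \oo] --> a -> (x n)%:C @[n --> \oo] --> a%:C.
Proof. by move=> xa; apply: cvgC_ReIm => //=; exact: cvg_cst. Qed.

(** [x + d] decreases and [x - d] increases. This replaces the summation of a
    majorant by the choice of a telescoping one. *)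
Lemma cvg_of_increments (x d : nat -> R) :
  (forall n, 0 <= d n) -> (forall n, `|x n.+1 - x n| <= d n - d n.+1) ->
  cvgn x.
Proof.
move=> d0 xd.
have ni : nonincreasing_seq (fun n => x n + d n).
  by apply/nonincreasing_seqP => n; have := xd n; rewrite ler_norml; lra.
have lb n : x 0%N - d 0%N <= x n - d n.
  elim: n => [//|n IH]; have := xd n; rewrite ler_norml; lra.
have dni : nonincreasing_seq d.
  apply/nonincreasing_seqP => n; rewrite -subr_ge0 (le_trans _ (xd n)) //.
have xdc : cvgn (fun n => x n + d n).
  apply: nonincreasing_is_cvgn => //; exists (x 0%N - d 0%N) => _ [n _ <-].
  by have := lb n; have := d0 n; lra.
have dc : cvgn d by apply: nonincreasing_is_cvgn => //; exists 0 => _ [n _ <-].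
have -> : x = (fun n => (x n + d n) - d n) by apply/funext => n; rewrite addrK.
exact: is_cvgB.
Qed.

Lemma cvgC_of_increments u (d : nat -> R) :
  (forall n, 0 <= d n) -> (forall n, normc (u n.+1 - u n) <= d n - d n.+1) ->
  exists l : R[i], u n @[n --> \oo] --> l.
Proof.
move=> d0 ud.
have [cRe cIm] : cvgn (fun n => complex.Re (u n)) /\ cvgn (fun n => complex.Im (u n)).
  split; apply: (cvg_of_increments d0) => n; apply: le_trans (ud n).
    by rewrite -ReN -ReD normc_Re.
  by rewrite -ImN -ImD normc_Im.
by eexists; apply: cvgC_ReIm; [exact: cRe|exact: cIm].
Qed.

Lemma normc_expC_sub1 z : normc (expC z - 1) <= 2 * (normc z * expR (normc z)).
Proof.
pose f (t : R) := expC (t%:C * z).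
have fd x : is_deriveC f x (z * f x).
  apply: is_deriveC_eq.
    exact: is_deriveC_expC (is_deriveCM (is_deriveC_id x) (is_deriveC_cst z x)).
  by rewrite mul1r mulr0 addr0.
have := is_deriveC_bound fd; rewrite /f mul1r mul0r expC0; apply => x x01.
rewrite normcM ler_wpM2l ?normc_ge0 // (le_trans (normc_expC_le _)) //.
rewrite ler_expR normcM normcR ler_piMl ?normc_ge0 //.
by rewrite ger0_norm; lra.
Qed.

Lemma cvg_expC u l : u n @[n --> \oo] --> l ->
  expC (u n) @[n --> \oo] --> expC l.
Proof.
move=> ul.
suff : expC l * expC (u n - l) @[n --> \oo] --> expC l * 1.
  by rewrite mulr1; under eq_fun do rewrite -expCD addrC subrK.
apply: cvgM; first exact: cvg_cst.
have dl : normc (u n - l) @[n --> \oo] --> (0 : R).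
  rewrite -(@normc0 R); apply: cvgC_normc; rewrite -(subrr l).
  by apply: cvgB => //; exact: cvg_cst.
apply: (@cvgC_squeeze _ _ (fun n => 2 * (normc (u n - l) * expR (normc (u n - l))))).
  by near=> n; exact: normc_expC_sub1.
have -> : (0 : R) = 2 * (0 * expR 0) by rewrite mul0r mulr0.
apply: cvgM; first exact: cvg_cst.
apply: cvgM => //; apply: continuous_cvg => //; exact: continuous_expR.
Unshelve. all: by end_near. Qed.

End ComplexConvergence.

Section ProductEstimates.
Variable R : realType.
Implicit Types (z w : R[i]).

(** With [h t = (1 + t w) exp (- t w)] one has [h' t = - t w ^ 2 exp (- t w)]:
    the first order terms cancel exactly. *)
Lemma expC_approx1 w :
  normc ((1 + w) * expC (- w) - 1) <= 2 * (normc w ^+ 2 * expR (normc w)).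
Proof.
pose e (t : R) := expC (t%:C * - w).
pose f (t : R) := (1 + t%:C * w) * e t.
have fd x : is_deriveC f x (- (x%:C * w ^+ 2) * e x).
  have idx := is_deriveC_id x; have cw a := is_deriveC_cst (a : R[i]) x.
  have ed := is_deriveC_expC (is_deriveCM idx (cw (- w))).
  apply: is_deriveC_eq.
    exact: (is_deriveCM (is_deriveCD (cw 1) (is_deriveCM idx (cw w))) ed).
  by rewrite /e; ring.
have := is_deriveC_bound fd; rewrite /f /e !mul1r !mul0r addr0 expC0 mul1r.
apply => x /andP[x0 x1]; have nx : normc x%:C <= 1 by rewrite normcR ger0_norm.
rewrite normcM normcN normcM normcX ler_pM ?mulr_ge0 ?exprn_ge0 ?normc_ge0 //.
  by rewrite ler_piMl ?exprn_ge0 ?normc_ge0.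
rewrite (le_trans (normc_expC_le _)) // ler_expR normcM normcN.
by rewrite ler_piMl ?normc_ge0.
Qed.

(** The same cancellation one order further:
    [h t = (1 + t w) exp (- t w + t ^ 2 w ^ 2 / 2)] has
    [h' t = t ^ 2 w ^ 3 exp (- t w + t ^ 2 w ^ 2 / 2)]. *)
Lemma expC_approx2 w :
  normc ((1 + w) * expC (- w + w ^+ 2 / 2) - 1)
  <= 2 * (normc w ^+ 3 * expR (normc w + normc w ^+ 2)).
Proof.
pose p (t : R) := t%:C * - w + t%:C * t%:C * (w ^+ 2 / 2).
pose f (t : R) := (1 + t%:C * w) * expC (p t).
have fd x : is_deriveC f x (x%:C ^+ 2 * w ^+ 3 * expC (p x)).
  have idx := is_deriveC_id x; have cw a := is_deriveC_cst (a : R[i]) x.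
  have pd := is_deriveCD (is_deriveCM idx (cw (- w)))
    (is_deriveCM (is_deriveCM idx idx) (cw (w ^+ 2 / 2))).
  apply: is_deriveC_eq.
    exact: (is_deriveCM (is_deriveCD (cw 1) (is_deriveCM idx (cw w)))
              (is_deriveC_expC pd)).
  by rewrite /p; field.
have := is_deriveC_bound fd.
rewrite /f /p !mul1r !mul0r !addr0 expC0 mul1r.
apply => x /andP[x0 x1]; have nx : normc x%:C <= 1 by rewrite normcR ger0_norm.
have nx2 : normc (x%:C * x%:C) <= 1 by rewrite normcM mulr_ile1 ?normc_ge0.
rewrite normcM (normcM (_ ^+ 2)) (normcX w) ler_pM ?mulr_ge0 ?exprn_ge0 ?normc_ge0 //.
  by rewrite ler_piMl ?exprn_ge0 ?normc_ge0.
rewrite (le_trans (normc_expC_le _)) // ler_expR (le_trans (ler_normcD _ _)) //.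
rewrite lerD // normcM.
  by rewrite normcN ler_piMl ?normc_ge0.
rewrite (le_trans (ler_piMl _ nx2)) ?normc_ge0 // normcM normcX normcV normcn.
by rewrite ler_piMr ?exprn_ge0 ?normc_ge0 // invf_le1 ?ltr0n // ler1n.
Qed.

(** Deviations from 1 are measured in the form [exp a - 1] because then they
    simply add up under products. *)
Lemma normc_mul_sub1 z w (a b : R) :
  normc (z - 1) <= expR a - 1 -> normc (w - 1) <= expR b - 1 ->
  normc (z * w - 1) <= expR (a + b) - 1.
Proof.
move=> za wb.
have -> : z * w - 1 = (z - 1) * (w - 1) + (z - 1) + (w - 1) by ring.
rewrite (le_trans (ler_normcD _ _)) // (le_trans (lerD (ler_normcD _ _) (lexx _))) //.
have -> : expR (a + b) - 1
    = (expR a - 1) * (expR b - 1) + (expR a - 1) + (expR b - 1).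
  by rewrite expRD; ring.
by rewrite !lerD // normcM ler_pM ?normc_ge0.
Qed.

Lemma normc_exp_sub1 z (a : R) n : normc (z - 1) <= expR a - 1 ->
  normc (z ^+ n - 1) <= expR (n%:R * a) - 1.
Proof.
move=> za; elim: n => [|n IH]; first by rewrite mul0r expR0 !subrr normc0.
by rewrite exprS -[n.+1]add1n natrD mulrDl mul1r normc_mul_sub1.
Qed.

Lemma normc_prod_sub1 (I : Type) (r : seq I) (P : pred I) (F : I -> R[i]) (a : I -> R) :
  (forall i, P i -> normc (F i - 1) <= expR (a i) - 1) ->
  normc (\prod_(i <- r | P i) F i - 1) <= expR (\sum_(i <- r | P i) a i) - 1.
Proof.
move=> Fa; elim/big_ind2 : _ => [|x a1 y a2 xa ya|//].
  by rewrite expR0 !subrr normc0.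
exact: normc_mul_sub1.
Qed.

Lemma le_expR_sub1 (x y : R) : x <= y -> x <= expR y - 1.
Proof. by move=> xy; have := expR_ge1Dx y; lra. Qed.

Lemma cvg_expR_sub1 (d : nat -> R) : d n @[n --> \oo] --> 0 ->
  expR (d n) - 1 @[n --> \oo] --> 0.
Proof.
move=> d0; rewrite -(subrr 1) -{2}expR0; apply: cvgB; last exact: cvg_cst.
by apply: continuous_cvg => //; exact: continuous_expR.
Qed.

(** Since [1 / k ^ 2 <= 1 / (k - 1) - 1 / k], the sum telescopes. *)
Lemma sum_inv_sqr_le (n m : nat) : (0 < n)%N -> (n <= m)%N ->
  \sum_(n.+1 <= k < m.+1) k%:R^-1 ^+ 2 <= n%:R^-1 - m%:R^-1 :> R.
Proof.
move=> n0; elim: m => [|m IH]; first by rewrite leqn0 => /eqP ->; rewrite big_geq // subrr.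
rewrite leq_eqVlt => /predU1P[<-|nm]; first by rewrite big_geq // subrr.
rewrite big_nat_recr //= (le_trans (lerD (IH nm) (lexx _))) //.
have m0 : 0 < m%:R :> R by rewrite ltr0n (leq_trans n0).
rewrite -addrA lerD2l -(natr1 m).
have m1 : 0 < m%:R + 1 :> R by lra.
have -> : (m%:R + 1)^-1 ^+ 2 = - (m%:R + 1)^-1 + m%:R^-1 - m%:R^-1 * (m%:R + 1)^-1 ^+ 2 :> R.
  by field; lra.
have : 0 <= m%:R^-1 * (m%:R + 1)^-1 ^+ 2 :> R by rewrite mulr_ge0 ?sqr_ge0 // invr_ge0 ltW.
lra.
Qed.

(** The product of the factors with [n < k <= m] is within [exp (C / n) - 1]
    of 1. With [n = 1] this bounds the partial products, so that their
    increments are [O(1 / k ^ 2)]; with [n] so large that the bound is at most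
    [1 / 2] it keeps the later partial products away from 0. *)
Lemma cvg_prod_neq0 (a : nat -> R[i]) (C : R) :
  (forall k, (0 < k)%N -> normc (a k - 1) <= expR (C * k%:R^-1 ^+ 2) - 1) ->
  exists2 l : R[i], \prod_(1 <= k < n.+1) a k @[n --> \oo] --> l &
    ((forall k, (0 < k)%N -> a k != 0) -> l != 0).
Proof.
move=> aC; pose P n := \prod_(1 <= k < n.+1) a k.
have C0 : 0 <= C.
  have := aC 1%N isT; rewrite invr1 expr1n mulr1 => h.
  by rewrite -ler_expR expR0 -subr_ge0 (le_trans _ h) ?normc_ge0.
have tail n m : (0 < n)%N -> (n <= m)%N ->
    normc (\prod_(n.+1 <= k < m.+1) a k - 1) <= expR (C / n%:R) - 1.
  move=> n0 nm; rewrite big_nat_cond.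
  apply: (@le_trans _ _ (expR (\sum_(n.+1 <= k < m.+1 | (n.+1 <= k < m.+1)%N && true)
      C * k%:R^-1 ^+ 2) - 1)).
    apply: normc_prod_sub1 => k; rewrite andbT => /andP[nk _].
    by apply: aC; exact: leq_trans nk.
  rewrite -big_nat_cond -mulr_sumr lerD2r ler_expR ler_wpM2l //.
  by rewrite (le_trans (sum_inv_sqr_le n0 nm)) // lerBlDr lerDl invr_ge0.
have PM n m : (n <= m)%N -> P m = P n * \prod_(n.+1 <= k < m.+1) a k.
  by move=> nm; rewrite /P (@big_cat_nat _ _ _ n.+1).
pose K := normc (P 1%N) * expR C.
have K0 : 0 <= K by rewrite mulr_ge0 ?normc_ge0 ?expR_ge0.
have PK n : (0 < n)%N -> normc (P n) <= K.
  move=> n0; rewrite (PM 1%N n) // normcM ler_wpM2l ?normc_ge0 //.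
  have := tail 1%N n isT n0; rewrite divr1 => h.
  by have := lerB_normc (\prod_(2 <= k < n.+1) a k) 1; rewrite normc1; lra.
(* [exp x - 1 <= x exp x] turns the exponential bounds into summable ones. *)
pose E := expR C.
have aE k : (0 < k)%N -> normc (a k - 1) <= C * E * k%:R^-1 ^+ 2.
  move=> k0; apply: le_trans (aC k k0) _.
  set x := C * _; have x0 : 0 <= x by rewrite mulr_ge0 ?sqr_ge0.
  have xC : x <= C by rewrite ler_piMr // exprn_ile1 ?invr_ge0 // invf_le1 ?ler1n ?ltr0n.
  rewrite mulrAC -/x.
  have h1 : x * expR x <= x * E by rewrite ler_wpM2l // ler_expR.
  apply: le_trans h1.
  have := expR_ge1Dx (- x); rewrite expRN => h.
  have := ler_wpM2r (expR_ge0 x) h; rewrite mulVf ?expR_eq0 // ?lt0r_neq0 ?expR_gt0 //; lra.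
have [l Pl] : exists l : R[i], P n.+1 @[n --> \oo] --> l.
  apply: (@cvgC_of_increments _ _ (fun n => K * (C * E) * n.+1%:R^-1)) => n.
    by rewrite mulr_ge0 ?invr_ge0 // mulr_ge0 // mulr_ge0 // expR_ge0.
  rewrite /P big_nat_recr //= -[X in _ - X]mulr1 -mulrBr normcM -mulrBr -mulrA.
  rewrite ler_pM ?normc_ge0 ?PK // (le_trans (aE _ _)) //.
  rewrite ler_wpM2l ?(mulr_ge0 C0 (expR_ge0 _)) //.
  have := @sum_inv_sqr_le n.+1 n.+2 isT (leqnSn _).
  by rewrite big_nat1.
exists l; first by rewrite -cvg_shiftS.
move=> a0; apply/eqP => l0.
have [n n0 Cn] : exists2 n, (0 < n)%N & expR (C / n%:R) - 1 <= 1 / 2.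
  have : expR (C / n.+1%:R) - 1 @[n --> \oo] --> 0.
    apply: cvg_expR_sub1; rewrite -(mulr0 C); apply: cvgM; first exact: cvg_cst.
    exact: cvg_harmonic.
  move=> /cvgrPdist_lt /(_ (1 / 2)) [|N _ /(_ N)]; first by lra.
  rewrite /= leqnn sub0r normrN => /(_ isT) h; exists N.+1 => //.
  by rewrite ltW // (le_lt_trans (ler_norm _)).
have Pn0 : P n != 0.
  by rewrite /P big_nat prodf_seq_neq0; apply/allP => k _; apply/implyP => /andP[k0 _]; exact: a0.
have /cvgC_normP : P m.+1 @[m --> \oo] --> (0 : R[i]) by rewrite -l0.
move=> /(_ (normc (P n) / 2)) [|N _ /(_ (maxn n N))].
  by rewrite divr_gt0 // normc_gt0.
rewrite /= leq_maxr subr0 => /(_ isT).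
have nN : (n <= (maxn n N).+1)%N by rewrite ltnW // ltnS leq_maxl.
rewrite (PM n) // normcM; have := tail n _ n0 nN; set Q := \prod_(_ <= k < _) _ => h.
have Q2 : 1 / 2 <= normc Q.
  by have := lerB_normc 1 Q; rewrite normcBC normc1; lra.
have : normc (P n) * (1 / 2) <= normc (P n) * normc Q by rewrite ler_wpM2l ?normc_ge0.
lra.
Qed.

End ProductEstimates.

(** * Euler's constant and the Barnes product *)

Section EulerGamma.
Variable R : realType.

Definition harm (n : nat) : R := \sum_(1 <= k < n.+1) k%:R^-1.

(** The increment [1 / (n + 2) - ln ((n + 2) / (n + 1))] lies between
    [1 / (n + 2) - 1 / (n + 1)] and 0. *)
Lemma cvg_euler_gamma : harm n - ln n%:R @[n --> \oo] --> (euler_gamma : R).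
Proof.
pose x n : R := harm n - ln n%:R.
suff /cvg_ex[l] : cvgn (fun n => x n.+1) by rewrite cvg_shiftS => /cvgP.
apply: (@cvg_of_increments _ _ (fun n => n.+1%:R^-1)) => n.
  by rewrite invr_ge0.
rewrite /x /harm big_nat_recr //=; set h := \sum_(_ <= _ < _) _.
have n1 : 0 < n.+1%:R :> R by [].
have n2 : 0 < n.+2%:R :> R by [].
have E : n.+2%:R = n.+1%:R + 1 :> R by rewrite natr1.
have up : ln n.+2%:R - ln n.+1%:R <= n.+1%:R^-1 :> R.
  rewrite -ln_div ?posrE // E mulrDl divff ?lt0r_neq0 // mul1r.
  by rewrite le_ln1Dx // (lt_trans _ (_ : 0 < _)) ?invr_gt0 // ltrN10.
have lo : n.+2%:R^-1 <= ln n.+2%:R - ln n.+1%:R :> R.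
  rewrite -lerN2 opprB -ln_div ?posrE //.
  have -> : n.+1%:R / n.+2%:R = 1 + - n.+2%:R^-1 :> R by rewrite -[n.+1%:R](addrK 1) -E mulrBl divff ?lt0r_neq0 // mul1r.
  rewrite le_ln1Dx // ltrN2 invf_lt1 // ltr1n //.
have ba : n.+2%:R^-1 <= n.+1%:R^-1 :> R by rewrite lef_pV2 ?posrE // ler_nat.
move: up lo ba; set a := n.+1%:R^-1; set b := n.+2%:R^-1.
set la := ln n.+1%:R; set lb := ln n.+2%:R => up lo ba.
by rewrite ler_norml; apply/andP; split; lra.
Qed.

End EulerGamma.

Section BarnesProduct.
Variable R : realType.
Implicit Types z w : R[i].

Definition barnes_prod z n := \prod_(1 <= k < n.+1)
  ((1 + z / k%:R) ^+ k * expC (- z + z ^+ 2 / (2 * k%:R))) : R[i].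

Definition approx2_cst z : R := 2 * normc z ^+ 3 * expR (normc z + normc z ^+ 2).

Lemma approx2_cst_ge0 z : 0 <= approx2_cst z.
Proof. by rewrite mulr_ge0 ?expR_ge0 // mulr_ge0 // exprn_ge0 // normc_ge0. Qed.

Lemma expC_approx2_div z k : (0 < k)%N ->
  normc ((1 + z / k%:R) * expC (- (z / k%:R) + (z / k%:R) ^+ 2 / 2) - 1) <=
  expR (approx2_cst z * k%:R^-1 ^+ 3) - 1.
Proof.
move=> k0; apply/le_expR_sub1; apply: le_trans (expC_approx2 _) _.
have nw : normc (z / k%:R) = normc z * k%:R^-1 by rewrite normcM normcV normcn.
have wz : normc (z / k%:R) <= normc z.
  by rewrite nw ler_piMr ?normc_ge0 // invf_le1 ?ltr0n // ler1n.
have -> : approx2_cst z * k%:R^-1 ^+ 3 =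
    2 * ((normc z * k%:R^-1) ^+ 3 * expR (normc z + normc z ^+ 2)).
  by rewrite /approx2_cst; ring.
rewrite {1}nw ler_wpM2l // ler_wpM2l ?exprn_ge0 ?mulr_ge0 ?normc_ge0 ?invr_ge0 //.
by rewrite ler_expR lerD // ler_pXn2r // nnegrE normc_ge0.
Qed.

(** The [k]-th factor is the [k]-th power of [(1 + w) exp (- w + w ^ 2 / 2)] at
    [w = z / k], which is [1 + O(k ^ - 3)]. *)
Lemma barnes_factor_approx z k : (0 < k)%N ->
  normc ((1 + z / k%:R) ^+ k * expC (- z + z ^+ 2 / (2 * k%:R)) - 1) <=
  expR (approx2_cst z * k%:R^-1 ^+ 2) - 1.
Proof.
move=> k0; have kC : k%:R != 0 :> R[i] by rewrite pnatr_eq0 -lt0n.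
have kR : k%:R != 0 :> R by rewrite pnatr_eq0 -lt0n.
have -> : - z + z ^+ 2 / (2 * k%:R) = k%:R * (- (z / k%:R) + (z / k%:R) ^+ 2 / 2).
  by field.
rewrite expCMn -exprMn.
have -> : approx2_cst z * k%:R^-1 ^+ 2 = k%:R * (approx2_cst z * k%:R^-1 ^+ 3) by field.
exact/normc_exp_sub1/expC_approx2_div.
Qed.

Lemma cvg_barnes_prod z : barnes_prod z n @[n --> \oo] --> limn (barnes_prod z).
Proof.
have [l pl _] := cvg_prod_neq0 (@barnes_factor_approx z).
by rewrite (cvg_lim _ pl).
Qed.

Lemma barnes_prod_lim_neq0 z :
  (forall k, (0 < k)%N -> z != - k%:R) -> limn (barnes_prod z) != 0.
Proof.
move=> zk; have [l pl l0] := cvg_prod_neq0 (@barnes_factor_approx z).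
rewrite (cvg_lim _ pl) //; apply: l0 => k k0.
have kC : k%:R != 0 :> R[i] by rewrite pnatr_eq0 -lt0n.
rewrite mulf_neq0 ?expC_neq0 // expf_neq0 //.
have -> : 1 + z / k%:R = (z + k%:R) / k%:R by rewrite mulrDl divff // addrC.
by rewrite mulf_neq0 ?invr_eq0 // addr_eq0 zk.
Qed.

Lemma barnes_prod_lim_eq0 j : limn (barnes_prod (- j.+1%:R)) = 0.
Proof.
have b0 n : (j < n)%N -> barnes_prod (- j.+1%:R) n = 0 :> R[i].
  move=> jn; apply/eqP; rewrite /barnes_prod prodf_seq_eq0; apply/hasP.
  exists j.+1; first by rewrite mem_index_iota.
  by rewrite /= mulNr divff ?pnatr_eq0 // subrr expr0n mul0r.
apply: cvg_lim => //; apply/cvgC_normP => e e0; exists j.+1 => // n /= jn.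
by rewrite -[\prod_(_ <= _ < _) _]/(barnes_prod _ n) b0 // subrr normc0.
Qed.

End BarnesProduct.

(** * The product formula for the sine *)

Section SineProduct.
Variable R : realType.
Implicit Types (z w : R[i]) (x : R).

Lemma sin_le_id x : 0 <= x -> sin x <= x.
Proof.
move=> x0; have [|c _] := MVT_segment x0 (fun y _ => is_derive_sin y).
  by apply: continuous_subspaceT => y; exact: continuous_sin.
by rewrite sin0 !subr0 => ->; rewrite ler_piMl // cos_le1.
Qed.

Lemma id_le_tan x : 0 <= x < pi / 2 -> x <= tan x.
Proof.
move=> /andP[x0 xpi].
have cos_gt0 y : y \in `[0, x] -> 0 < cos y.
  by rewrite in_itv /= => /andP[y0 yx]; rewrite cos_gt0_pihalf //; lra.
have dtan y : y \in `[0, x] -> is_derive y 1 (@tan R) (cos y ^- 2).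
  by move=> /cos_gt0 y0; apply: is_derive_tan; rewrite gt_eqF.
pose dt (y : R) : R := (cos y ^+ 2)^-1.
have dtan_oo y : y \in `]0, x[ -> is_derive y 1 (@tan R) (dt y).
  by move=> yx; apply: dtan; exact: subset_itv_oo_cc yx.
have ctan : {within `[0, x], continuous (@tan R)}.
  by apply: derivable_within_continuous => y /dtan yd; exact: ex_derive.
have [c c0x] := MVT_segment x0 dtan_oo ctan.
rewrite tan0 !subr0 => ->; have c_gt0 := cos_gt0 _ c0x.
by rewrite ler_peMl // invf_ge1 ?exprn_gt0 // exprn_ile1 ?cos_le1 // ltW.
Qed.

Lemma sin_natpi k : sin (k%:R * pi) = 0 :> R.
Proof.
elim: k => [|k IH]; first by rewrite mul0r sin0.
by rewrite -natr1 mulrDl mul1r sinDpi IH oppr0.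
Qed.

Lemma tan_node_bound n k : (k < n.+1)%N -> 0 <= k%:R * (pi : R) / n.*2.+1%:R < pi / 2.
Proof.
move=> kn; rewrite divr_ge0 ?mulr_ge0 ?pi_ge0 //= ltr_pdivrMr //.
rewrite mulrAC -mulrA mulrC -subr_gt0.
have -> : pi * (n.*2.+1%:R / 2) - pi * k%:R = pi * (n.*2.+1%:R - 2 * k%:R) / 2 :> R by field.
rewrite divr_gt0 // mulr_gt0 ?pi_gt0 // subr_gt0 -natrM ltr_nat; lia.
Qed.

(** With [t = tan (k pi / N)] one has [1 + i t = exp (i k pi / N) / cos (k pi / N)],
    so that [(1 + i t) ^ N = (1 - i t) ^ N]: these are [N] distinct roots for
    [|k| < N / 2]. The constant is fixed by the derivative at 0. *)
Lemma binomial_difference_factor (n : nat) (N := n.*2.+1) z :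
  (1 + z) ^+ N - (1 - z) ^+ N = 2 * N%:R * z *
    \prod_(1 <= k < n.+1) (1 + z ^+ 2 / (tan (k%:R * pi / N%:R))%:C ^+ 2).
Proof.
have simp0 := (@mul0r R, @mul1r R, @mulr0 R, @subr0 R, @addr0 R, @add0r R,
  @sub0r R, @oppr0 R, @mulr1 R).
have Npos : 0 < N%:R :> R by [].
have pi0 := @pi_gt0 R.
pose u k : R := k%:R * pi / N%:R; pose t k : R := tan (u k).
have u_bound k (kn : (k < n.+1)%N) : 0 <= u k < pi / 2 := tan_node_bound kn.
have t_gt0 k : (0 < k < n.+1)%N -> 0 < t k.
  move=> /andP[k0 kn]; have := u_bound _ kn => /id_le_tan; apply: lt_le_trans.
  by rewrite divr_gt0 // mulr_gt0 // ltr0n.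
have u_itv k : (k < n.+1)%N -> u k \in `](- (pi / 2)), (pi / 2)[.
  by move=> /u_bound/andP[u1 u2]; rewrite in_itv /=; apply/andP; split => //; lra.
have t_inj k l : (k < n.+1)%N -> (l < n.+1)%N -> t k = t l -> k = l.
  move=> kn ln /(tan_inj (u_itv _ kn) (u_itv _ ln)).
  move=> /(mulIf (invr_neq0 (lt0r_neq0 Npos))) /(mulIf (lt0r_neq0 pi0)) /eqP.
  by rewrite eqr_nat => /eqP.
pose r k : R[i] := 'i * (t k)%:C.
have rr k : r k * r k = - (t k)%:C ^+ 2.
  by rewrite /r mulrACA -!expr2 sqr_i mulN1r.
(* As N is odd, [- (1 - x) ^ N = (x - 1) ^ N]: p is a sum of monic polynomials. *)
pose p : {poly R[i]} := ('X - (-1)%:P) ^+ N + ('X - 1%:P) ^+ N.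
have pE y : p.[y] = (1 + y) ^+ N - (1 - y) ^+ N.
  rewrite /p hornerD !horner_exp !hornerXsubC opprK (addrC 1 y); congr (_ + _).
  by rewrite -opprB exprNn /N -signr_odd /= odd_double expr1 mulN1r.
have p_root k : (k < n.+1)%N -> root p (r k).
  move=> kn; have ck : cos (u k) != 0.
    by have /andP[h1 h2] := u_bound _ kn; rewrite gt_eqF // cos_gt0_pihalf //; lra.
  have cC : (cos (u k))%:C != 0 :> R[i] by rewrite fmorph_eq0.
  have cr : (cos (u k))%:C * (1 + r k) = cos (u k) +i* sin (u k).
    by apply: complex_ext; rewrite /r /t /tan /= ?simp0 // mulrC divfK.
  have cr' : (cos (u k))%:C * (1 - r k) = cos (u k) -i* sin (u k).
    by apply: complex_ext; rewrite /r /t /tan /= ?simp0 // mulrN mulrC divfK.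
  rewrite /root pE subr_eq0; apply/eqP/(mulfI (expf_neq0 N cC)).
  rewrite -!exprMn cr cr' -expC_imag -sinN -(cosN (u k)) -expC_imag -!expCMn.
  have Nu : N%:R * u k = k%:R * pi by rewrite /u mulrC divfK // lt0r_neq0.
  have NuC (x : R) : N%:R * ('i * x%:C) = 'i * (N%:R * x)%:C :> R[i].
    by rewrite mulrCA -(rmorph_nat (real_complex R)) -rmorphM.
  by rewrite !NuC mulrN Nu !expC_imag sinN cosN sin_natpi oppr0.
have p_rootN k : (k < n.+1)%N -> root p (- r k).
  move=> /p_root/rootP; rewrite pE => rk; apply/rootP.
  by rewrite pE opprK -opprB rk oppr0.
pose rs := 0 :: [seq r k | k <- index_iota 1 n.+1] ++ [seq - r k | k <- index_iota 1 n.+1].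
have rI k l : (k < n.+1)%N -> (l < n.+1)%N -> r k = r l -> k = l.
  by move=> kn ln /(congr1 (@complex.Im R)); rewrite /r /= ?simp0; exact: t_inj.
have r_neq0 k : (0 < k < n.+1)%N -> r k != 0.
  move=> /t_gt0 tk; apply/eqP => /(congr1 (@complex.Im R)).
  by rewrite /r /= ?simp0 => tk0; move: tk; rewrite tk0 ltxx.
have rs_uniq : uniq_roots rs.
  have inj_r : {in index_iota 1 n.+1 &, injective r}.
    by move=> k l; rewrite !mem_index_iota => /andP[_ kn] /andP[_ ln]; exact: rI.
  have inj_Nr : {in index_iota 1 n.+1 &, injective (fun k => - r k)}.
    by move=> k l kn ln /oppr_inj; exact: inj_r.
  rewrite uniq_rootsE /= mem_cat negb_or cat_uniq !map_inj_in_uniq ?iota_uniq //= andbT.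
  rewrite -andbA; apply/and3P; split; [| |apply/hasPn => _ /mapP[k kb ->]]; apply/mapP => -[l].
  - by rewrite mem_index_iota => /r_neq0 /eqP + /esym.
  - by rewrite mem_index_iota => /r_neq0 /eqP + /esym /eqP; rewrite oppr_eq0 => + /eqP.
  move: kb; rewrite !mem_index_iota => /t_gt0 tk /t_gt0 tl /(congr1 (@complex.Im R)).
  by rewrite ImN /r /= ?simp0 => h; lra.
have rs_root : all (root p) rs.
  rewrite /= all_cat !all_map {1}/root pE addr0 subr0 subrr eqxx /=.
  apply/andP; split; apply/allP => k; rewrite mem_index_iota => /andP[_ kn] /=.
    exact: p_root.
  exact: p_rootN.
have p_size : size p = (size rs).+1.
  have -> : size rs = N.
    by rewrite /= size_cat !size_map size_iota subn1 /= addnn.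
  have sX (a : R[i]) : size (('X - a%:P) ^+ N) = N.+1 by rewrite size_exp_XsubC.
  have lX (a : R[i]) : (('X - a%:P) ^+ N)`_N = 1.
    have /monicP := monic_exp N (monicXsubC a).
    by rewrite /lead_coef sX.
  apply/eqP; rewrite eqn_leq (leq_trans (size_polyD _ _)) ?sX ?maxnn //=.
  rewrite ltnNge; apply/negP => /leq_sizeP/(_ N (leqnn _))/eqP.
  by rewrite coefD !lX -(natrD _ 1 1) pnatr_eq0.
have {rs_root rs_uniq p_size} pfac := all_roots_prod_XsubC p_size rs_root rs_uniq.
move: (lead_coef p) pfac => c pfac.
pose q : {poly R[i]} := \prod_(1 <= k < n.+1) ('X ^+ 2 + ((t k)%:C ^+ 2)%:P).
have pq : p = c *: ('X * q).
  rewrite [LHS]pfac /rs big_cons big_cat !big_map subr0 /= -big_split /=.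
  congr (_ *: (_ * _)); apply: eq_bigr => k _.
  have -> : (t k)%:C ^+ 2 = - (r k * r k) by rewrite rr opprK.
  by rewrite !polyCN (polyCM (r k) (r k)) !opprK -expr2 -subr_sqr.
have dp : p^`().[0] = 2 * N%:R.
  rewrite /p derivD !deriv_exp !derivXsubC !mul1r hornerD !hornerMn !horner_exp.
  rewrite !hornerXsubC /= opprK add0r expr1n sub0r -signr_odd odd_double expr0.
  by rewrite mulr_natl mulr2n.
have cq : c * q.[0] = 2 * N%:R.
  by rewrite -dp pq derivZ hornerZ derivM derivX mul1r hornerD hornerM hornerX mul0r addr0.
rewrite -pE pq hornerZ hornerM hornerX -cq.
rewrite (mulrAC c) -!mulrA; congr (_ * (_ * _)).
rewrite /q !horner_prod -big_split /= !big_nat; apply: eq_bigr => k k_bd.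
have tC : (t k)%:C ^+ 2 != 0 by rewrite expf_neq0 // fmorph_eq0 gt_eqF // t_gt0.
by rewrite !hornerE /= expr0n add0r mulrDr mulr1 mulrCA mulfV // mulr1 addrC.
Qed.

Lemma expC_exp_approx z N : (0 < N)%N ->
  normc ((1 + z / N%:R) ^+ N * expC (- z) - 1) <=
  expR (2 * normc z ^+ 2 * expR (normc z) / N%:R) - 1.
Proof.
move=> N0; have NC : N%:R != 0 :> R[i] by rewrite pnatr_eq0 -lt0n.
have NR : N%:R != 0 :> R by rewrite pnatr_eq0 -lt0n.
have {1}-> : - z = N%:R * - (z / N%:R) by rewrite mulrN mulrC divfK.
rewrite expCMn -exprMn.
have -> : 2 * normc z ^+ 2 * expR (normc z) / N%:R
   = N%:R * (2 * ((normc z / N%:R) ^+ 2 * expR (normc z))) by field.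
apply/normc_exp_sub1/le_expR_sub1; apply: le_trans (expC_approx1 _) _.
have nw : normc (z / N%:R) = normc z / N%:R by rewrite normcM normcV normcn.
rewrite {1}nw ler_wpM2l // ler_wpM2l ?exprn_ge0 ?divr_ge0 ?normc_ge0 // ler_expR.
by rewrite nw ler_piMr ?normc_ge0 // invf_le1 ?ltr0n // ler1n.
Qed.

Lemma cvg_expC_exp z (N : nat -> nat) : (forall n, (n < N n)%N) ->
  (1 + z / (N n)%:R) ^+ N n @[n --> \oo] --> expC z.
Proof.
move=> nN.
have -> : (fun n => (1 + z / (N n)%:R) ^+ N n)
    = fun n => (1 + z / (N n)%:R) ^+ N n * expC (- z) * expC z.
  by apply/funext => n; rewrite -mulrA expCNM mulr1.
rewrite -[X in _ --> X]mul1r; apply: cvgM; last exact: cvg_cst.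
set K := 2 * normc z ^+ 2 * expR (normc z).
have K0 : 0 <= K by rewrite mulr_ge0 ?expR_ge0 // mulr_ge0 ?sqr_ge0.
apply: (@cvgC_squeeze _ _ _ (fun n => expR (K * n.+1%:R^-1) - 1)).
  near=> n; apply: le_trans (expC_exp_approx _ _) _; first exact: leq_ltn_trans (nN n).
  rewrite lerD2r ler_expR ler_wpM2l // lef_pV2 ?posrE ?ltr0n //.
    by rewrite ler_nat.
  exact: leq_ltn_trans (nN n).
apply: cvg_expR_sub1; rewrite -(mulr0 K); apply: cvgM; first exact: cvg_cst.
exact: cvg_harmonic.
Unshelve. all: by end_near. Qed.

Definition sine_prod (b : R[i]) n := \prod_(1 <= k < n.+1) (1 - b ^+ 2 / k%:R ^+ 2).

Lemma sine_factor_neq0 (b : R[i]) k : (0 < k)%N -> b != k%:R -> b != - k%:R ->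
  1 - b ^+ 2 / k%:R ^+ 2 != 0.
Proof.
move=> k0 bk bNk; have kC : k%:R != 0 :> R[i] by rewrite pnatr_eq0 -lt0n.
have -> : 1 - b ^+ 2 / k%:R ^+ 2 = (k%:R - b) * (k%:R + b) / k%:R ^+ 2 by field.
rewrite mulf_neq0 ?invr_eq0 ?expf_neq0 // mulf_neq0 //; first by rewrite subr_eq0 eq_sym.
by rewrite addrC addr_eq0.
Qed.

Lemma sine_factor_cvg (b : R[i]) : 1 - b ^+ 2 / n.+1%:R ^+ 2 @[n --> \oo] --> (1 : R[i]).
Proof.
rewrite -[X in _ --> X](subr0 1); apply: cvgB; first exact: cvg_cst.
apply: (@cvgC_squeeze _ _ _ (fun n => normc b ^+ 2 * n.+1%:R^-1)).
  near=> n; rewrite subr0 normcM normcV !normcX normcn ler_wpM2l ?sqr_ge0 //.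
  by rewrite lef_pV2 ?posrE // ?exprn_gt0 // expr2 ler_peMr // ler1n.
rewrite -(mulr0 (normc b ^+ 2)); apply: cvgM; first exact: cvg_cst.
exact: cvg_harmonic.
Unshelve. all: by end_near. Qed.

Lemma sine_factor_inv_bounded (b : R[i]) :
  (forall k, (0 < k)%N -> 1 - b ^+ 2 / k%:R ^+ 2 != 0) ->
  exists2 C : R, 0 <= C &
    forall k, (0 < k)%N -> normc (1 - b ^+ 2 / k%:R ^+ 2)^-1 <= C.
Proof.
move=> nz; have inv_cvg : normc (1 - b ^+ 2 / n.+1%:R ^+ 2)^-1 @[n --> \oo] --> normc (1^-1 : R[i]).
  apply: cvgC_normc; apply: cvgV; first exact: oner_neq0.
  exact: sine_factor_cvg.
have /cvg_seq_bounded/pinfty_ex_gt0[C C0 HC] := cvgP _ inv_cvg.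
exists C => [|[//|k] _]; first exact: ltW.
by rewrite (le_trans (ler_norm _)) // (HC k).
Qed.

Lemma sine_prod_limit (b : R[i]) :
  exists2 l : R[i], sine_prod b n @[n --> \oo] --> l &
    ((forall k, (0 < k)%N -> 1 - b ^+ 2 / k%:R ^+ 2 != 0) -> l != 0).
Proof.
apply: (@cvg_prod_neq0 _ _ (normc b ^+ 2)) => k k0; apply: le_expR_sub1.
by rewrite addrAC subrr add0r normcN normcM normcV !normcX normcn exprVn.
Qed.

(** Euler's product for the sine. The finite product for the odd exponent [N]
    has factors [1 - (b ^ 2 / k ^ 2) (u / tan u) ^ 2] at [u = k pi / N], and
    [cos u <= u / tan u <= 1]; hence its ratio to [sine_prod b n] has factors
    [1 + O(u ^ 2 / k ^ 2) = 1 + O(N ^ - 2)], of which there are fewer than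
    [N]. *)
Lemma cvg_sine_prod (b : R[i]) :
  b != 0 -> (forall k, (0 < k)%N -> 1 - b ^+ 2 / k%:R ^+ 2 != 0) ->
  sine_prod b n @[n --> \oo] -->
    (expC ('i * pi%:C * b) - expC (- ('i * pi%:C * b))) / (2 * ('i * pi%:C * b)).
Proof.
move=> b0 nz; have [C C0 HC] := sine_factor_inv_bounded nz.
have pi0 := @pi_gt0 R; set z : R[i] := 'i * pi%:C * b.
have iC : 'i != 0 :> R[i] by apply/eqP => /(congr1 (@complex.Im R)) /eqP; rewrite oner_eq0.
have piC : pi%:C != 0 :> R[i] by rewrite fmorph_eq0 gt_eqF.
have z0 : z != 0 by rewrite !mulf_neq0.
pose N n := n.*2.+1.
pose t n k : R := tan (k%:R * pi / (N n)%:R).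
pose d n k : R[i] := (1 + (z / (N n)%:R) ^+ 2 / (t n k)%:C ^+ 2) * (1 - b ^+ 2 / k%:R ^+ 2)^-1.
have NC n : (N n)%:R != 0 :> R[i] by rewrite pnatr_eq0.
have sineE n : ((1 + z / (N n)%:R) ^+ N n - (1 - z / (N n)%:R) ^+ N n) / (2 * z)
    = sine_prod b n * \prod_(1 <= k < n.+1) d n k.
  rewrite binomial_difference_factor -/(N n) /sine_prod -big_split /=.
  have -> : 2 * (N n)%:R * (z / (N n)%:R) = 2 * z by field.
  rewrite mulrAC divff ?mulf_neq0 // mul1r !big_nat; apply: eq_bigr => k /andP[k0 _].
  by rewrite /d mulrCA mulfV ?nz // mulr1.
have dE n k : (0 < k < n.+1)%N ->
    normc (d n k - 1) <= C * normc b ^+ 2 * pi ^+ 2 * (N n)%:R^-1 ^+ 2.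
  move=> /andP[k0 kn]; have NR : 0 < (N n)%:R :> R by rewrite ltr0n.
  have kR : 0 < k%:R :> R by rewrite ltr0n.
  have kC : k%:R != 0 :> R[i] by rewrite pnatr_eq0 -lt0n.
  set u := k%:R * pi / (N n)%:R : R.
  have u0 : 0 < u by rewrite divr_gt0 // mulr_gt0.
  have upi : u < pi / 2 by have /andP[] := @tan_node_bound n k kn.
  have ut : u <= tan u by rewrite id_le_tan // ltW.
  have t0 : 0 < tan u by exact: lt_le_trans ut.
  have cu : 0 < cos u by rewrite cos_gt0_pihalf //; lra.
  have tC : (tan u)%:C != 0 :> R[i] by rewrite fmorph_eq0 gt_eqF.
  pose rho := (u / tan u) ^+ 2.
  have ut0 : 0 < u / tan u by rewrite divr_gt0.
  have ut1 : u / tan u <= 1 by rewrite ler_pdivrMr // mul1r.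
  have rho1 : rho <= 1 by rewrite exprn_ile1 // ltW.
  have rho_ge : 1 - rho <= u ^+ 2.
    have su : sin u <= u by rewrite sin_le_id // ltW.
    have su0 : 0 < sin u by rewrite sin_gt0_pihalf // u0.
    have cut : cos u <= u / tan u.
      by rewrite /tan invf_div mulrA ler_pdivlMr // mulrC ler_wpM2r // ltW.
    have : cos u ^+ 2 <= rho by rewrite /rho ler_pXn2r ?nnegrE ?(ltW cu) ?(ltW ut0) ?(ltW su0) ?(ltW u0).
    rewrite cos2sin2; have : sin u ^+ 2 <= u ^+ 2 by rewrite ler_pXn2r ?nnegrE ?(ltW cu) ?(ltW ut0) ?(ltW su0) ?(ltW u0).
    lra.
  have uC : u%:C = k%:R * pi%:C / (N n)%:R :> R[i].
    by rewrite /u !rmorphM fmorphV !rmorph_nat.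
  have -> : d n k - 1 = b ^+ 2 / k%:R ^+ 2 * (1 - rho)%:C * (1 - b ^+ 2 / k%:R ^+ 2)^-1.
    have i2 : z ^+ 2 = - (pi%:C * b) ^+ 2 by rewrite /z -mulrA exprMn sqr_i mulN1r.
    apply: (mulIf (nz k k0)); rewrite mulrBl /d !divfK ?nz // mul1r.
    have -> : (1 - rho)%:C = 1 - (u%:C / (tan u)%:C) ^+ 2 :> R[i].
      by rewrite rmorphB rmorph1 rmorphXn fmorph_div.
    rewrite uC exprMn exprVn i2.
    rewrite /t -/u; field.
    by rewrite NC tC kC.
  rewrite !normcM normcR normcV !normcX normcn ger0_norm ?subr_ge0 //.
  have -> : C * normc b ^+ 2 * pi ^+ 2 * (N n)%:R^-1 ^+ 2
     = normc b ^+ 2 / k%:R ^+ 2 * u ^+ 2 * C.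
    by rewrite /u; field; rewrite !gt_eqF.
  rewrite ler_pM ?normc_ge0 ?HC //.
    by rewrite mulr_ge0 ?subr_ge0 // divr_ge0 ?sqr_ge0.
  by rewrite ler_wpM2l // divr_ge0 ?sqr_ge0.
have d_cvg : \prod_(1 <= k < n.+1) d n k @[n --> \oo] --> (1 : R[i]).
  set K := C * normc b ^+ 2 * pi ^+ 2.
  have K0 : 0 <= K by rewrite mulr_ge0 ?sqr_ge0 // mulr_ge0 ?sqr_ge0.
  apply: (@cvgC_squeeze _ _ _ (fun n => expR (K * n.+1%:R^-1) - 1)).
    near=> n; rewrite big_nat.
    apply: le_trans (normc_prod_sub1 (a := fun=> K * (N n)%:R^-1 ^+ 2) _ _) _.
      by move=> k /dE kE; exact: le_expR_sub1.
    rewrite lerD2r ler_expR -big_nat sumr_const_nat subSS subn0 -[_ *+ n]mulr_natr -(mulrA K).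
    rewrite ler_wpM2l // expr2 -mulrA.
    apply: (@le_trans _ _ ((N n)%:R^-1 * 1)).
      rewrite ler_wpM2l ?invr_ge0 // mulrC ler_pdivrMr ?ltr0n // mul1r ler_nat /N; lia.
    by rewrite mulr1 lef_pV2 ?posrE // ler_nat /N; lia.
  apply: cvg_expR_sub1; rewrite -(mulr0 K); apply: cvgM; first exact: cvg_cst.
  exact: cvg_harmonic.
have [l sl _] := sine_prod_limit b.
suff -> : (expC z - expC (- z)) / (2 * z) = l by [].
have sdl : sine_prod b n * \prod_(1 <= k < n.+1) d n k @[n --> \oo] --> l.
  exact: cvgC_mul sl d_cvg (mulr1 l).
have nN n : (n < N n)%N by rewrite /N; lia.
have zl := @cvg_expC_exp z N nN; have Nzl := @cvg_expC_exp (- z) N nN.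
have zNzl := cvgC_sub zl Nzl.
apply: (cvgC_unique _ sdl); have -> : (fun n => sine_prod b n * \prod_(1 <= k < n.+1) d n k) =
    fun n => ((1 + z / (N n)%:R) ^+ N n - (1 + - z / (N n)%:R) ^+ N n) * (2 * z)^-1.
  by apply/funext => n; rewrite -sineE mulNr.
exact: (cvgC_mul zNzl (@cvgC_cst R (2 * z)^-1) erefl).
Unshelve. all: by end_near. Qed.

End SineProduct.

(** * The Fourier coefficients *)

Section FourierCoefficients.
Variable R : realType.
Implicit Types (beta : R[i]) (phi : R[i] -> R[i]).

Lemma is_derive_continuous (f df : R -> R) :
  (forall x : R, is_derive x (1 : R) f (df x)) -> continuous f.
Proof.
move=> fd x; apply: differentiable_continuous; apply/derivable1_diffP.
exact: (@ex_derive _ _ _ _ _ _ _ (fd x)).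
Qed.

(** The integrand need only be a derivative on the open interval: the values
    of a symbol at the endpoints are unspecified. *)
Lemma Rintegral_derivative (a b : R) (g f df : R -> R) : a < b ->
  (forall x : R, is_derive x (1 : R) f (df x)) -> continuous df ->
  (forall x, a < x < b -> g x = df x) ->
  \int[lebesgue_measure]_(x in `[a, b]) g x = f b - f a.
Proof.
move=> ab fd cdf gE.
have mdf : measurable_fun `]a, b[ df.
  by apply: (measurable_funS measurableT) => //; exact: continuous_measurable_fun.
have gE' : {in `]a, b[, df =1 g} by move=> x; rewrite in_itv /= => /gE ->.
have mg : measurable_fun `]a, b[ g.
  by apply: eq_measurable_fun mdf => x; rewrite inE => /gE' ->.
rewrite /Rintegral integral_itv_bndoo; last exact/measurable_EFinP.
have -> : (\int[lebesgue_measure]_(x in `]a, b[) (g x)%:E =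
           \int[lebesgue_measure]_(x in `]a, b[) (df x)%:E)%E.
  by apply: eq_integral => x; rewrite inE => /gE' ->.
rewrite -(integral_itv_bndoo true false); last exact/measurable_EFinP.
rewrite (@continuous_FTC2 _ df f) //.
- exact: continuous_subspaceT.
- have cf := is_derive_continuous fd; split.
  + by move=> x _; exact: (@ex_derive _ _ _ _ _ _ _ (fd x)).
  + exact: cvg_at_right_filter (cf a).
  + exact: cvg_at_left_filter (cf b).
- by move=> x _; rewrite derive1E; exact: (@derive_val _ _ _ _ _ _ _ (fd x)).
Qed.

Lemma integralC_expC (a b : R) (c d : R[i]) (g : R -> R[i]) : a < b -> c != 0 ->
  (forall x, a < x < b -> g x = expC (x%:C * c + d)) ->
  integralC `[a, b] g = (expC (b%:C * c + d) - expC (a%:C * c + d)) / c.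
Proof.
move=> ab c0 gE; pose e (w : R[i]) x := w * expC (x%:C * c + d).
have ed w x : is_deriveC (e w) x (e (w * c) x).
  have arg := is_deriveCD (is_deriveCM (is_deriveC_id x) (is_deriveC_cst c x))
    (is_deriveC_cst d x).
  apply: is_deriveC_eq (is_deriveCM (is_deriveC_cst w x) (is_deriveC_expC arg)) _.
  by rewrite /e; ring.
have ec w : continuous (fun x => complex.Re (e w x)) /\
            continuous (fun x => complex.Im (e w x)).
  split; first exact: (is_derive_continuous (fun x => (ed w x).1)).
  exact: (is_derive_continuous (fun x => (ed w x).2)).
have -> : (expC (b%:C * c + d) - expC (a%:C * c + d)) / c = e c^-1 b - e c^-1 a.
  by rewrite /e; field.
have gE' x : a < x < b -> g x = e (c^-1 * c) x.
  by move=> /gE ->; rewrite /e mulVf // mul1r.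
apply: complex_ext; rewrite /= ?ReD ?ImD ?ReN ?ImN.
  apply: (Rintegral_derivative ab (fun x => (ed c^-1 x).1) (ec _).1) => x /gE' ->.
  by [].
apply: (Rintegral_derivative ab (fun x => (ed c^-1 x).2) (ec _).2) => x /gE' ->.
by [].
Qed.

Lemma expC_2pi_int (k : int) : expC ('i * k%:~R * (2 * pi)%:C) = 1 :> R[i].
Proof.
have e2pi : expC ('i * (2 * pi)%:C) = 1 :> R[i].
  by rewrite expC_imag mulr_natl cos2pi sin2pi.
have en (n : nat) : expC (n%:R * ('i * (2 * pi)%:C)) = 1 :> R[i].
  by rewrite expCMn e2pi expr1n.
have -> : 'i * k%:~R * (2 * pi)%:C = k%:~R * ('i * (2 * pi)%:C) :> R[i] by ring.
case: k => n; first exact: en.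
by rewrite NegzE mulrNz mulNr expCN en invr1.
Qed.

(** [sin (pi beta) / pi] *)
Definition csinpi beta : R[i] :=
  (expC ('i * pi%:C * beta) - expC (- ('i * pi%:C * beta))) / (2 * ('i * pi%:C)).

Lemma i_neq0 : 'i != 0 :> R[i].
Proof. by apply/eqP => /(congr1 (@complex.Im R)) /eqP; rewrite oner_eq0. Qed.

Lemma piC_neq0 : pi%:C != 0 :> R[i].
Proof. by rewrite fmorph_eq0 gt_eqF // pi_gt0. Qed.

Lemma fourier_coef_t_symbol beta phi (k : int) :
  is_t_symbol beta phi -> beta != k%:~R ->
  fourier_coef phi k = csinpi beta / (beta - k%:~R).
Proof.
move=> hphi bk; have i0 := i_neq0; have pi0 := piC_neq0.
have bk0 : beta - k%:~R != 0 by rewrite subr_eq0.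
have c0 : 'i * (beta - k%:~R) != 0 by rewrite mulf_neq0.
rewrite /fourier_coef (integralC_expC (d := - ('i * pi%:C * beta)) _ c0).
- have -> : (2 * pi)%:C * ('i * (beta - k%:~R)) + - ('i * pi%:C * beta)
      = 'i * pi%:C * beta + - ('i * k%:~R * (2 * pi)%:C).
    by rewrite rmorphM rmorph_nat; ring.
  rewrite expCD expCN expC_2pi_int invr1 mulr1 mul0r add0r /csinpi.
  have -> : ((2 * pi)^-1)%:C = (2 * pi%:C)^-1 :> R[i] by rewrite fmorphV rmorphM rmorph_nat.
  move: (pi%:C) pi0 (expC _) (expC _) => p p0 e1 e2; field.
  by rewrite p0 i0 bk0.
- by rewrite mulr_gt0 // pi_gt0.
- move=> x x2pi; rewrite hphi // -expCD; congr expC.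
  by rewrite rmorphB; ring.
Qed.

End FourierCoefficients.

(** * The determinant in closed form *)

Section CauchyDeterminant.
Variable F : fieldType.

Lemma det_scale_rows_cols n (r s : 'I_n -> F) (A : 'M[F]_n) :
  \det (\matrix_(i, j) (r i * A i j * s j)) = \prod_i r i * \det A * \prod_j s j.
Proof.
have -> : \matrix_(i, j) (r i * A i j * s j)
    = diag_mx (\row_i r i) *m A *m diag_mx (\row_j s j).
  by apply/matrixP => i j; rewrite mul_mx_diag mul_diag_mx !mxE.
rewrite !det_mulmx !det_diag; congr (_ * _ * _); apply: eq_bigr => i _; by rewrite mxE.
Qed.

(** Eliminating the first column of the matrix leaves a Cauchy matrix for the
    shifted sequences, with rows and columns rescaled. *)
Lemma det_cauchy n (a b : nat -> F) : (forall i j, a i != b j) ->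
  \det (\matrix_(i < n, j < n) (a i - b j)^-1) =
  \prod_(j < n) ((a j - b j)^-1 *
    \prod_(i < j) ((a i - a j) * (b j - b i) / ((a i - b j) * (a j - b i)))).
Proof.
elim: n a b => [|n IH] a b ab; first by rewrite det_mx00 big_ord0.
have ab0 i j : a i - b j != 0 by rewrite subr_eq0.
set M := \matrix_(i, j) _.
pose c := (a 0%N - b 0%N)^-1.
pose r (j : 'I_n) := (a 0%N - a j.+1) / (a j.+1 - b 0%N).
pose s (k : 'I_n) := (b k.+1 - b 0%N) / (a 0%N - b k.+1).
pose A' := \matrix_(i < n, j < n) (a i.+1 - b j.+1)^-1.
pose X : 'cV[F]_n := \col_j (- (a j.+1 - b 0%N)^-1 / c).
pose Y : 'rV[F]_n := \row_k (a 0%N - b k.+1)^-1.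
have c0 : c != 0 by rewrite invr_eq0 ab0.
have elimM : block_mx 1%:M 0 X 1%:M *m (M : 'M[F]_(1 + n))
    = block_mx c%:M Y 0 (\matrix_(i, j) (r i * A' i j * s j)).
  rewrite -(@submxK _ 1 n 1 n M) mulmx_block !mul1mx !mul0mx !addr0.
  congr block_mx; apply/matrixP => i j; rewrite !mxE ?big_ord1 ?mxE /= ?ord1 //.
    by rewrite add1n /c invrK mulfK ?addNr // ab0.
  by rewrite !add1n /r /s /c; field; rewrite !ab0 oner_neq0.
have -> : \det M = c * \det (\matrix_(i, j) (r i * A' i j * s j)).
  rewrite -[RHS](_ : \det (block_mx 1%:M 0 X 1%:M *m (M : 'M[F]_(1 + n))) = _).
    by rewrite det_mulmx det_lblock !det1 !mul1r.
  by rewrite elimM det_ublock det_scalar1.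
rewrite det_scale_rows_cols (IH (a \o S) (b \o S)) //= big_ord_recl big_ord0 mulr1.
congr (_ * _); rewrite mulrAC -!big_split /=.
apply: eq_bigr => j _; rewrite big_ord_recl /= mulrCA; congr (_ * (_ * _)).
by rewrite /r /s /bump /=; field; rewrite !ab0.
Qed.

End CauchyDeterminant.

Section WeightedProducts.
Variables (F : fieldType) (L : nat -> F).

(** The denominator left over when the factors [L m] of the determinant are
    collected by [m]. *)
Definition window_prod n :=
  \prod_(n.+1 <= m < n.*2.+1) (L m ^+ (m - n) * L m.*2 ^+ (n.*2 - m)).

(** Passing from [n] to [n + 1] shifts the exponents by [- 1] and [+ 2] and moves
    the window; the auxiliary product [W] has the new exponents on the old
    window. *)
Lemma window_prod_step n : L n.+1.*2 != 0 ->
  window_prod n.+1 * \prod_(n.+1 <= m < n.*2.+1) L m =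
  window_prod n * L n.*2.+1 ^+ n * L n.*2.+1.*2 *
    \prod_(n.+1 <= m < n.*2.+1) L m.*2 ^+ 2.
Proof.
move=> L0; pose H m := L m ^+ (m - n.+1) * L m.*2 ^+ (n.+1.*2 - m).
pose W := \prod_(n.+1 <= m < n.*2.+1) H m.
have Vn1 : window_prod n.+1 = W * L n.*2.+1 ^+ n * L n.*2.+1.*2.
  have : \prod_(n.+1 <= m < n.+1.*2.+1) H m = L n.+1.*2 ^+ n.+1 * window_prod n.+1.
    rewrite big_ltn; last lia.
    by rewrite {1}/H subnn mul1r; congr (L _ ^+ _ * _); lia.
  rewrite doubleS big_nat_recr /=; last lia.
  rewrite big_nat_recr /=; last lia.
  rewrite -/W => E; apply: (mulfI (expf_neq0 n.+1 L0)); rewrite -E /H.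
  have -> : (n.*2.+1 - n.+1 = n)%N by lia.
  have -> : (n.+1.*2 - n.*2.+1 = 1)%N by lia.
  have -> : (n.*2.+2 - n.+1 = n.+1)%N by lia.
  have -> : (n.+1.*2 - n.*2.+2 = 0)%N by lia.
  by rewrite doubleS; ring.
have WV : W * \prod_(n.+1 <= m < n.*2.+1) L m =
    window_prod n * \prod_(n.+1 <= m < n.*2.+1) L m.*2 ^+ 2.
  rewrite -!big_split /= !big_nat; apply: eq_bigr => m /andP[nm mn]; rewrite /H.
  have -> : (n.+1.*2 - m = (n.*2 - m).+2)%N by lia.
  have -> : (m - n = (m - n.+1).+1)%N by lia.
  by rewrite !exprS; ring.
rewrite Vn1 [LHS]mulrAC (mulrAC W) WV -!mulrA; congr (_ * _).
by rewrite mulrC -mulrA.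
Qed.

End WeightedProducts.

Section ToeplitzHankel.
Variable R : realType.
Implicit Types (beta : R[i]) (phi : R[i] -> R[i]).

Definition lfac beta m : R[i] := 1 - 2 * beta / m%:R.

(** The ratio of the determinants of orders [r + 1] and [r], which is read off
    from [det_cauchy]. The factor [csinpi beta / beta] is kept over
    [sine_prod beta r] because it is the limit of the latter. *)
Definition det_ratio beta r : R[i] :=
  csinpi beta / beta / sine_prod beta r * (lfac beta r.*2.+1 / lfac beta r.*2.+1.*2)
  * \prod_(r.+1 <= m < r.*2.+1) (lfac beta m / lfac beta m.*2 ^+ 2).

Lemma lfac_double beta m : lfac beta m.*2 = 1 - beta / m%:R.
Proof.
rewrite /lfac -muln2 natrM; have [->|m0] := eqVneq (m%:R : R[i]) 0.
  by rewrite mul0r invr0 !mulr0.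
by congr (1 - _); field; rewrite m0.
Qed.

(** With [x = beta - j - 1 / 2] and [y = k + 1 / 2] the two Fourier
    coefficients in an entry are multiples of [1 / (x + y)] and [1 / (x - y)],
    whose sum is [2 x / (x ^ 2 - y ^ 2)]. *)
Lemma det_toeplitz_hankel beta phi n :
  is_t_symbol beta phi -> (forall m : int, beta != m%:~R) ->
  \det (toeplitz_hankel n phi) = \prod_(r < n) det_ratio beta r.
Proof.
move=> hphi bZ.
have bn (m : nat) : beta - m%:R != 0 by rewrite subr_eq0; exact: (bZ m).
have bNn (m : nat) : beta + m%:R != 0.
  by rewrite -(opprK m%:R) subr_eq0; have := bZ (- m%:Z); rewrite mulrNz.
have b0 : beta != 0 by have := bn 0%N; rewrite subr0.
(* [x j] is twice [beta - j - 1 / 2]; [a] and [b] are the two sequences of squares. *)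
pose x j : R[i] := 2 * beta - (2 * j%:R + 1).
pose a j : R[i] := (beta - j%:R - 1 / 2) ^+ 2.
pose b k : R[i] := (k%:R + 1 / 2) ^+ 2.
have abE i j : a i - b j = (beta - (i + j).+1%:R) * (beta - i%:R + j%:R).
  by rewrite /a /b -(natr1 (i + j)) natrD; field.
have bij (i j : nat) : beta - i%:R + j%:R != 0.
  have := bZ (i%:Z - j%:Z); rewrite rmorphB /= -subr_eq0 opprB addrA.
  by rewrite addrAC.
have ab i j : a i != b j by rewrite -subr_eq0 abE mulf_neq0.
have -> : toeplitz_hankel n phi = \matrix_(j < n, k < n)
    (csinpi beta * x j * (\matrix_(i < n, l < n) (a i - b l)^-1) j k * 1).
  apply/matrixP => j k; rewrite !mxE mulr1 !(fourier_coef_t_symbol hphi (bZ _)).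
  rewrite !rmorphD rmorphN /= opprB abE /x.
  have := bij j k; have := bn (j + k).+1; rewrite -(natr1 (j + k)) natrD => h1 h2.
  by field; rewrite h2 h1.
rewrite (det_scale_rows_cols (fun j : 'I_n => csinpi beta * x j) (fun=> 1)).
rewrite [X in _ * X]big1 // mulr1 (det_cauchy n ab) -big_split /=; apply: eq_bigr => r _.
have -> : \prod_(i < r) ((a i - a r) * (b r - b i) / ((a i - b r) * (a r - b i)))
    = (sine_prod beta r)^-1 *
      \prod_(r.+1 <= m < r.*2.+1) (lfac beta m / lfac beta m.*2 ^+ 2).
  rewrite /sine_prod big_add1 big_nat_rev /= add0n big_mkord.
  rewrite -prodfV -[r.+1]add0n big_addn subSS -addnn addnK big_mkord -big_split /=.
  apply: eq_bigr => i _; rewrite !abE lfac_double /lfac.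
  have ir : (i < r)%N := ltn_ord i.
  have -> : (r - i.+1).+1 = (r - i)%N by lia.
  pose d := (r - i)%N; pose m := (i + r.+1)%N.
  have dE : r%:R = i%:R + d%:R :> R[i] by rewrite -natrD /d; congr (_%:R); lia.
  have mE : m%:R = i%:R + r%:R + 1 :> R[i] by rewrite /m natrD -(natr1 r) addrA.
  have d0 : d%:R != 0 :> R[i] by rewrite pnatr_eq0 /d; lia.
  have m0 : m%:R != 0 :> R[i] by rewrite pnatr_eq0 /m; lia.
  have bm := bn m; have bd := bn d; have bNd := bNn d.
  rewrite -/d -/m.
  have -> : (i + r).+1 = m by rewrite /m; lia.
  have -> : (r + i).+1 = m by rewrite /m; lia.
  have -> : a i - a r = d%:R * (2 * beta - m%:R) by rewrite /a mE dE; field.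
  have -> : b r - b i = d%:R * m%:R by rewrite /b mE dE; field.
  have -> : beta - i%:R + r%:R = beta + d%:R by rewrite dE; ring.
  have -> : beta - r%:R + i%:R = beta - d%:R by rewrite dE; ring.
  have mb : m%:R - beta != 0 by rewrite -oppr_eq0 opprB.
  have db : d%:R ^+ 2 - beta ^+ 2 != 0.
    by rewrite subr_sqr mulf_neq0 1?addrC // -oppr_eq0 opprD opprK.
  by field; rewrite m0 mb d0 db bd bm bNd.
rewrite /det_ratio lfac_double /lfac /x abE.
have := bn (r + r).+1; rewrite addnn; have : r.*2.+1%:R != 0 :> R[i] by rewrite pnatr_eq0.
have -> : beta - r%:R + r%:R = beta by rewrite subrK.
have -> : r.*2.+1%:R = 2 * r%:R + 1 :> R[i] by rewrite -(natr1 r.*2) -muln2 natrM mulrC.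
move: (sine_prod _ _)^-1 (\prod_(_ <= _ < _) _) => S P r0 r1.
field; rewrite r0 b0 r1 !andbT /=.
by rewrite -oppr_eq0 opprB.
Qed.

Lemma sine_factors_neq0 beta : (forall m : int, beta != m%:~R) ->
  forall k, (0 < k)%N -> 1 - beta ^+ 2 / k%:R ^+ 2 != 0.
Proof.
move=> bZ k k0; apply: sine_factor_neq0 => //; first exact: (bZ k).
by have := bZ (- k%:Z); rewrite mulrNz.
Qed.

Lemma cvg_sine_prod_csinpi beta : (forall m : int, beta != m%:~R) ->
  sine_prod beta n @[n --> \oo] --> csinpi beta / beta.
Proof.
move=> bZ; have b0 : beta != 0 := bZ 0.
have -> : csinpi beta / beta =
    (expC ('i * pi%:C * beta) - expC (- ('i * pi%:C * beta))) / (2 * ('i * pi%:C * beta)).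
  by rewrite /csinpi -[LHS]mulrA -invfM; congr (_ * _^-1); rewrite -[LHS]mulrA.
exact: cvg_sine_prod b0 (sine_factors_neq0 bZ).
Qed.

Lemma csinpi_neq0 beta : (forall m : int, beta != m%:~R) -> csinpi beta != 0.
Proof.
move=> bZ; have [l sl /(_ (sine_factors_neq0 bZ))] := sine_prod_limit beta.
by rewrite (cvgC_unique sl (cvg_sine_prod_csinpi bZ)) mulf_eq0 negb_or => /andP[].
Qed.

End ToeplitzHankel.

(** * Zeros of the determinant, and its factors collected by index *)

Section DeterminantProduct.
Variables (R : realType) (beta : R[i]).
Hypothesis bZ : forall m : int, beta != m%:~R.

Lemma lfac_eq0 m : (0 < m)%N -> (lfac beta m == 0) = (2 * beta == m%:R).
Proof.
move=> m0; have mC : m%:R != 0 :> R[i] by rewrite pnatr_eq0 -lt0n.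
rewrite /lfac subr_eq0 eq_sym; apply/eqP/eqP => [h|->]; last by rewrite divff.
by rewrite -[LHS](divfK mC) h mul1r.
Qed.

Lemma lfac_double_neq0 m : (0 < m)%N -> lfac beta m.*2 != 0.
Proof.
move=> m0; rewrite lfac_eq0 ?double_gt0 // -muln2 natrM mulrC.
by rewrite (inj_eq (mulIf _)) ?pnatr_eq0 //; exact: (bZ m).
Qed.

Lemma sine_prod_neq0 n : sine_prod beta n != 0.
Proof.
rewrite /sine_prod prodf_seq_neq0; apply/allP => k; rewrite mem_index_iota => /andP[k0 _].
exact: (sine_factors_neq0 bZ).
Qed.

(** As [beta] is not an integer, [2 beta = m] forces [m] to be odd. *)
Lemma lfac_eq0_half m : (0 < m)%N -> lfac beta m = 0 ->
  exists2 j, m = j.*2.+1 & beta = j%:R + 1 / 2.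
Proof.
move=> m0 /eqP; have [mo|me] := boolP (odd m); last first.
  have mE : m = m./2.*2 by rewrite -[LHS]odd_double_half (negPf me).
  by rewrite mE (negPf (lfac_double_neq0 _)) // -double_gt0 -mE.
have mE : m = m./2.*2.+1 by rewrite -[LHS]odd_double_half mo.
rewrite lfac_eq0 // {1}mE -(natr1 m./2.*2) -muln2 natrM => /eqP h.
exists m./2 => //; have -> : beta = 2 * beta / 2 by field.
by rewrite h; field.
Qed.

Lemma prod_det_ratio_eq0 n :
  \prod_(r < n) det_ratio beta r = 0 <->
  exists2 j : nat, (j < n)%N & beta = j%:R + 1 / 2.
Proof.
split=> [/eqP/prodf_eq0[r _]|[j jn bj]].
  have nz : csinpi beta / beta / sine_prod beta r != 0.
    have b0 : beta != 0 := bZ 0.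
    rewrite mulf_neq0 ?invr_eq0 ?sine_prod_neq0 // mulf_neq0 ?invr_eq0 //.
    exact: csinpi_neq0.
  rewrite /det_ratio mulf_eq0 mulf_eq0 (negPf nz) /= mulf_eq0 invr_eq0.
  rewrite (negPf (lfac_double_neq0 _)) // orbF => /orP[/eqP/lfac_eq0_half[] // j rj bj|].
    by exists j => //; have := ltn_ord r; lia.
  rewrite prodf_seq_eq0 => /hasP[m]; rewrite mem_index_iota /= => /andP[rm mr].
  have m0 : (0 < m)%N by lia.
  rewrite mulf_eq0 invr_eq0 expf_eq0 /= (negPf (lfac_double_neq0 m0)) orbF.
  move=> /eqP/(lfac_eq0_half m0)[j mj bj].
  by exists j => //; have := ltn_ord r; lia.
apply/eqP/prodf_eq0; exists (Ordinal jn) => //=; rewrite /det_ratio.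
have -> : lfac beta j.*2.+1 = 0.
  apply/eqP; rewrite lfac_eq0 // bj -(natr1 j.*2) -muln2 natrM; by apply/eqP; field.
by rewrite mul0r mulr0 mul0r.
Qed.

(** The tails [S / sine_prod beta r] multiply by Abel summation: the [k]-th sine
    factor is missing from the sine products with [r < k], whence its exponent
    [k]. The factors [lfac beta m] are collected by [window_prod_step]. *)
Lemma prod_det_ratioE n : (forall m, (0 < m)%N -> lfac beta m != 0) ->
  \prod_(r < n) det_ratio beta r =
  (csinpi beta / beta / sine_prod beta n) ^+ n
  * \prod_(1 <= k < n.+1)
      ((1 - beta ^+ 2 / k%:R ^+ 2) ^+ k * lfac beta k.*2.-1 ^+ k)
  / window_prod (lfac beta) n.
Proof.
move=> L0; set S := csinpi beta / beta.
have V0 n' : window_prod (lfac beta) n' != 0.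
  rewrite /window_prod big_nat prodf_seq_neq0; apply/allP => m _; apply/implyP => /andP[nm _].
  by rewrite mulf_neq0 // expf_neq0 // L0 //; lia.
elim: n => [|n IH].
  rewrite big_ord0 expr0 big_geq // mul1r /window_prod big_geq // divr1 //.
rewrite big_ord_recr /= IH {IH} [in RHS]big_nat_recr //=.
have -> : det_ratio beta n = S / sine_prod beta n *
    (lfac beta n.*2.+1 ^+ n.+1 * window_prod (lfac beta) n / window_prod (lfac beta) n.+1).
  rewrite /det_ratio -/S -[LHS]mulrA; congr (_ * _).
  have step := window_prod_step (lfac_double_neq0 (ltn0Sn n)).
  rewrite big_split /= prodfV.
  have P20 : \prod_(n.+1 <= m < n.*2.+1) lfac beta m.*2 ^+ 2 != 0.
    rewrite big_nat prodf_seq_neq0; apply/allP => m _; apply/implyP => /andP[nm _].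
    by rewrite expf_neq0 // lfac_double_neq0 //; lia.
  have q0 : lfac beta n.*2.+1.*2 != 0 by rewrite lfac_double_neq0.
  move: step P20 (V0 n) (V0 n.+1) q0.
  move: (\prod_(_ <= _ < _) _) (\prod_(_ <= _ < _) _ ^+ 2) => P P2.
  move: (window_prod _ n) (window_prod _ n.+1) (lfac beta n.*2.+1) (lfac beta n.*2.+1.*2) => V V1 l q.
  move=> step P20 Vn0 V10 q0.
  have -> : P = V * l ^+ n * q * P2 / V1 by rewrite -step mulrC mulKf.
  by rewrite exprS; field; rewrite P20 V10 q0.
have -> : sine_prod beta n.+1 = sine_prod beta n * (1 - beta ^+ 2 / n.+1%:R ^+ 2).
  by rewrite /sine_prod big_nat_recr.
have q0 : 1 - beta ^+ 2 / n.+1%:R ^+ 2 != 0 by exact: (sine_factors_neq0 bZ).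
move: (sine_prod_neq0 n) (V0 n) (V0 n.+1) q0.
move: (\prod_(1 <= k < n.+1) _) (lfac beta n.*2.+1) => P l.
move: (sine_prod _ _) (window_prod _ n) (window_prod _ n.+1) (1 - _ / _) S => s V V1 q S.
move=> s0 Vn0 V10 q0.
rewrite !(exprS _ n) !exprMn !exprVn !exprMn.
have sn0 : s ^+ n != 0 by rewrite expf_neq0.
have qn0 : q ^+ n != 0 by rewrite expf_neq0.
by field; rewrite V10 qn0 sn0 q0 s0 Vn0.
Qed.

End DeterminantProduct.

(** * The tail of the sine product *)

Section SineTail.
Variables (R : realType) (beta : R[i]).

(** The factor is compared with [exp (- beta ^ 2 (1 / (i - 1) - 1 / i))] and not
    with [exp (- beta ^ 2 / i ^ 2)], because the former telescopes. The error
    [O(1 / (i ^ 2 (i - 1)))] is stated as [O(1 / (n i ^ 2))], so that the sum over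
    [i > n] is [O(1 / n ^ 2)]. *)
Lemma sine_factor_approx :
  exists2 K : R, 0 <= K & forall n i, (0 < n < i)%N ->
    normc ((1 - beta ^+ 2 / i%:R ^+ 2) * expC (beta ^+ 2 * (i.-1%:R^-1 - i%:R^-1)) - 1)
    <= expR (K / n%:R * i%:R^-1 ^+ 2) - 1.
Proof.
pose B : R := normc beta ^+ 2; have B0 : 0 <= B by rewrite sqr_ge0.
(* The first term comes from [(1 + w) exp (- w)], the second from [exp v]. *)
exists (2 * B ^+ 2 * expR B + 2 * B * expR B).
  by rewrite addr_ge0 // mulr_ge0 // mulr_ge0 // sqr_ge0.
move=> n [|i]; first by rewrite andbF.
move=> /andP[n0]; rewrite ltnS => ni /=.
have i0 : (0 < i)%N by exact: leq_trans ni.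
have iC : i%:R != 0 :> R[i] by rewrite pnatr_eq0 -lt0n.
have i1C : i.+1%:R != 0 :> R[i] by rewrite pnatr_eq0.
have nR : 0 < n%:R :> R by rewrite ltr0n.
have iR : 0 < i%:R :> R by rewrite ltr0n.
have i1R : 0 < i.+1%:R :> R by rewrite ltr0n.
pose w : R[i] := - (beta ^+ 2 / i.+1%:R ^+ 2).
pose v : R[i] := beta ^+ 2 / (i.+1%:R ^+ 2 * i%:R).
have -> : (1 - beta ^+ 2 / i.+1%:R ^+ 2) * expC (beta ^+ 2 * (i%:R^-1 - i.+1%:R^-1))
    = ((1 + w) * expC (- w)) * expC v.
  rewrite -[RHS]mulrA -expCD; congr (_ * expC _).
  rewrite /w /v; have iE : i.+1%:R = i%:R + 1 :> R[i] by rewrite natr1.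
  by rewrite iE in i1C *; field; rewrite iC i1C.
have -> : (2 * B ^+ 2 * expR B + 2 * B * expR B) / n%:R * i.+1%:R^-1 ^+ 2
   = 2 * B ^+ 2 * expR B * (n%:R^-1 * i.+1%:R^-1 ^+ 2)
     + 2 * (B * (n%:R^-1 * i.+1%:R^-1 ^+ 2) * expR B) by ring.
set u : R := n%:R^-1 * i.+1%:R^-1 ^+ 2.
have iinv1 : i.+1%:R^-1 <= 1 :> R by rewrite invf_le1 // ler1n.
have i2 : 0 <= (i.+1%:R^-1 : R) ^+ 2 <= 1.
  by rewrite sqr_ge0 exprn_ile1 // invr_ge0 ltW.
have inv_le : i.+1%:R^-1 <= n%:R^-1 :> R.
  by rewrite lef_pV2 ?posrE // ler_nat ltnW.
have inv_le' : i%:R^-1 <= n%:R^-1 :> R by rewrite lef_pV2 ?posrE // ler_nat.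
have u0 : 0 <= u by rewrite mulr_ge0 ?invr_ge0 ?sqr_ge0 // ltW.
have wE : normc w = B * i.+1%:R^-1 ^+ 2.
  by rewrite /w normcN normcM normcV !normcX normcn exprVn.
have vE : normc v = B * (i%:R^-1 * i.+1%:R^-1 ^+ 2).
  by rewrite /v normcM normcV (normcM (i.+1%:R ^+ 2)) !normcX !normcn invfM exprVn (mulrC i%:R^-1).
have n1 : n%:R^-1 <= 1 :> R by rewrite invf_le1 // ler1n.
have wB : normc w <= B by rewrite wE ler_piMr //; case/andP: i2.
have vu : normc v <= B * u by rewrite vE ler_wpM2l // ler_wpM2r // sqr_ge0.
have uB : B * u <= B.
  rewrite ler_piMr // mulr_ile1 ?invr_ge0 ?ler0n //; by case/andP: i2.
apply: normc_mul_sub1; apply: le_expR_sub1.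
  apply: le_trans (expC_approx1 w) _.
  have -> : 2 * B ^+ 2 * expR B * u = 2 * (B ^+ 2 * u * expR B) by ring.
  rewrite ler_wpM2l // ler_pM ?sqr_ge0 ?expR_ge0 ?ler_expR //.
  rewrite wE exprMn ler_wpM2l ?sqr_ge0 // /u expr2 ler_wpM2r ?sqr_ge0 //.
  rewrite (le_trans _ inv_le) // expr2 ler_piMl ?invr_ge0 //.
apply: le_trans (normc_expC_sub1 v) _; rewrite ler_wpM2l //.
by rewrite ler_pM ?normc_ge0 ?expR_ge0 // ler_expR (le_trans vu).
Qed.

Lemma cvgC_normc_le (u : nat -> R[i]) (l a : R[i]) (c : R) : u n @[n --> \oo] --> l ->
  (\forall n \near \oo, normc (u n - a) <= c) -> normc (l - a) <= c.
Proof.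
move=> /cvgC_normP ul uc; apply/ler_addgt0Pr => e /ul {}ul.
have [n [/= nl nc]] := filter_ex (filterI ul uc).
have -> : l - a = (u n - a) - (u n - l) by ring.
by rewrite (le_trans (ler_normcB _ _)) // lerD // ltW.
Qed.

(** [S / sine_prod beta n] is [exp (- beta ^ 2 / n)] up to a factor
    [1 + O(1 / n ^ 2)], which stays negligible after taking the [n]-th power. *)
Lemma cvg_sine_tail (S : R[i]) :
  (forall k, (0 < k)%N -> 1 - beta ^+ 2 / k%:R ^+ 2 != 0) ->
  sine_prod beta n @[n --> \oo] --> S ->
  (S / sine_prod beta n) ^+ n @[n --> \oo] --> expC (- beta ^+ 2).
Proof.
move=> nz sS; have [K K0 HK] := sine_factor_approx.
have s0 n : sine_prod beta n != 0.
  rewrite /sine_prod prodf_seq_neq0; apply/allP => k; rewrite mem_index_iota => /andP[k0 _].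
  exact: nz.
have tail n : (0 < n)%N ->
    normc (S / sine_prod beta n * expC (beta ^+ 2 / n%:R) - 1) <= expR (K / n%:R ^+ 2) - 1.
  move=> n0; pose g M := sine_prod beta M / sine_prod beta n
    * expC (beta ^+ 2 * (n%:R^-1 - M%:R^-1)).
  have gE M : (n <= M)%N -> g M = \prod_(n.+1 <= i < M.+1)
      ((1 - beta ^+ 2 / i%:R ^+ 2) * expC (beta ^+ 2 * (i.-1%:R^-1 - i%:R^-1))).
    elim: M => [|M IH]; first by rewrite leqn0 => /eqP n0'; rewrite n0' in n0.
    rewrite leq_eqVlt => /predU1P[<-|nM].
      by rewrite big_geq // /g subrr mulr0 expC0 mulr1 divff.
    rewrite big_nat_recr //= -IH // /g.
    have -> : sine_prod beta M.+1 = sine_prod beta M * (1 - beta ^+ 2 / M.+1%:R ^+ 2).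
      by rewrite /sine_prod big_nat_recr.
    have -> : beta ^+ 2 * (n%:R^-1 - M.+1%:R^-1)
      = beta ^+ 2 * (n%:R^-1 - M%:R^-1) + beta ^+ 2 * (M%:R^-1 - M.+1%:R^-1) by ring.
    by rewrite expCD; ring.
  have gb M : (n <= M)%N -> normc (g M - 1) <= expR (K / n%:R ^+ 2) - 1.
    move=> nM; rewrite gE // big_nat.
    apply: le_trans (normc_prod_sub1 (a := fun i => K / n%:R * i%:R^-1 ^+ 2) _ _) _.
      by move=> i /andP[ni _]; apply: HK; rewrite n0.
    rewrite lerD2r ler_expR -big_nat -mulr_sumr.
    have nR : 0 < n%:R :> R by rewrite ltr0n.
    have -> : K / n%:R ^+ 2 = K / n%:R * n%:R^-1 by rewrite expr2 invfM mulrA.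
    rewrite ler_wpM2l ?divr_ge0 //.
    by rewrite (le_trans (sum_inv_sqr_le _ n0 nM)) // lerBlDr lerDl invr_ge0.
  apply: (@cvgC_normc_le (fun M => g M)); last by exists n => // M /= nM; exact: gb.
  have invM : (M%:R^-1 : R[i]) @[M --> \oo] --> (0 : R[i]).
    apply: (@cvgC_squeeze _ _ _ (fun M => M%:R^-1)).
      by near=> M; rewrite subr0 normcV normcn.
    by rewrite -cvg_shiftS; exact: cvg_harmonic.
  apply: cvgC_mul erefl; first exact: (cvgC_mul sS (@cvgC_cst R _) erefl).
  apply: cvg_expC; have -> : beta ^+ 2 / n%:R = beta ^+ 2 * (n%:R^-1 - 0) by rewrite subr0.
  exact: (cvgC_mul (@cvgC_cst R _) (cvgC_sub (@cvgC_cst R _) invM) erefl).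
have -> : expC (- beta ^+ 2) = 1 * expC (- beta ^+ 2) by rewrite mul1r.
have H : (S / sine_prod beta n) ^+ n * expC (beta ^+ 2) @[n --> \oo] --> (1 : R[i]).
  apply: (@cvgC_squeeze _ _ _ (fun n => expR (K * n%:R^-1) - 1)).
    exists 1%N => // n /= n0; have nC : n%:R != 0 :> R[i] by rewrite pnatr_eq0 -lt0n.
    have nR : n%:R != 0 :> R by rewrite pnatr_eq0 -lt0n.
    have -> : beta ^+ 2 = n%:R * (beta ^+ 2 / n%:R) by rewrite mulrC divfK.
    rewrite expCMn -exprMn.
    have -> : K * n%:R^-1 = n%:R * (K / n%:R ^+ 2) by field.
    by apply: normc_exp_sub1; exact: tail.
  apply: cvg_expR_sub1; rewrite -(mulr0 K); apply: cvgM; first exact: cvg_cst.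
  by rewrite -cvg_shiftS; exact: cvg_harmonic.
have -> : (fun n => (S / sine_prod beta n) ^+ n) = fun n =>
    (S / sine_prod beta n) ^+ n * expC (beta ^+ 2) * expC (- beta ^+ 2).
  by apply/funext => n; rewrite -mulrA (mulrC (expC _)) expCNM mulr1.
exact: (cvgC_mul H (@cvgC_cst R _) erefl).
Unshelve. all: by end_near. Qed.

End SineTail.

(** * The remaining window of factors *)

Section WindowProduct.
Variables (R : realType) (beta : R[i]).

Definition window_sum (n : nat) : R :=
  \sum_(n.+1 <= m < n.*2.+1) (3 / 2 * m%:R^-1 - n%:R * m%:R^-1 ^+ 2).

(** Each factor [1 + w] is compared with [exp (w - w ^ 2 / 2)]; the terms of
    first order in [beta] add up to exactly [n beta]. *)
Lemma cvg_window_prod :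
  window_prod (lfac beta) n * expC (n%:R * beta + beta ^+ 2 * (window_sum n)%:C)
    @[n --> \oo] --> (1 : R[i]).
Proof.
pose e (z : R[i]) (m : nat) := - (z / m%:R) + (z / m%:R) ^+ 2 / 2.
pose G n m := (lfac beta m * expC (e (- (2 * beta)) m)) ^+ (m - n)
  * (lfac beta m.*2 * expC (e (- beta) m)) ^+ (n.*2 - m).
have WE n : window_prod (lfac beta) n * expC (n%:R * beta + beta ^+ 2 * (window_sum n)%:C)
    = \prod_(n.+1 <= m < n.*2.+1) G n m.
  have -> : n%:R * beta + beta ^+ 2 * (window_sum n)%:C =
      \sum_(n.+1 <= m < n.*2.+1) ((m - n)%:R * e (- (2 * beta)) m
                                  + (n.*2 - m)%:R * e (- beta) m).
    have -> : n%:R * beta = \sum_(n.+1 <= m < n.*2.+1) beta.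
      by rewrite sumr_const_nat subSS -addnn addnK mulr_natl.
    rewrite /window_sum rmorph_sum /= mulr_sumr -big_split /= !big_nat.
    apply: eq_bigr => m /andP[nm mn]; rewrite natrB; last exact: ltnW.
    rewrite natrB // -muln2 natrM /e.
    have -> : (3 / 2 * m%:R^-1 - n%:R * m%:R^-1 ^+ 2)%:C
        = 3 / 2 * m%:R^-1 - n%:R * m%:R^-1 ^+ 2 :> R[i].
      by rewrite !(rmorphB, rmorphXn, fmorphV, rmorph_nat, rmorphM).
    have m0 : m%:R != 0 :> R[i] by rewrite pnatr_eq0; lia.
    by field.
  rewrite expC_sum /window_prod -big_split /=; apply: eq_bigr => m _.
  rewrite expCD !expCMn /G [(lfac beta m * _) ^+ _]exprMn.
  by rewrite [(lfac beta m.*2 * _) ^+ _]exprMn mulrACA.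
pose K := approx2_cst (- (2 * beta)) + approx2_cst (- beta).
have K0 : 0 <= K by rewrite addr_ge0 // approx2_cst_ge0.
have GE n m : (n.+1 <= m < n.*2.+1)%N ->
    normc (G n m - 1) <= expR (K * m%:R^-1 ^+ 2) - 1.
  move=> /andP[nm mn]; have m0 : (0 < m)%N by exact: leq_trans nm.
  have mR : 0 < m%:R :> R by rewrite ltr0n.
  have half z p : (p <= m)%N -> p%:R * (approx2_cst z * m%:R^-1 ^+ 3)
      <= approx2_cst z * m%:R^-1 ^+ 2 :> R.
    move=> pm; rewrite mulrCA ler_wpM2l ?approx2_cst_ge0 // exprS mulrA.
    by rewrite ler_piMl ?sqr_ge0 // ler_pdivrMr // mul1r ler_nat.
  have l1 : lfac beta m = 1 + - (2 * beta) / m%:R by rewrite /lfac mulNr.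
  have l2 : lfac beta m.*2 = 1 + - beta / m%:R by rewrite lfac_double mulNr.
  rewrite /G l1 l2 [K * _]mulrDl; apply: normc_mul_sub1.
    apply: le_trans (normc_exp_sub1 _ (expC_approx2_div _ m0)) _.
    by rewrite lerD2r ler_expR half // leq_subr.
  apply: le_trans (normc_exp_sub1 _ (expC_approx2_div _ m0)) _.
  by rewrite lerD2r ler_expR half //; lia.
apply: (@cvgC_squeeze _ _ _ (fun n => expR (K * n%:R^-1) - 1)).
  exists 1%N => // n /= n0; rewrite WE big_nat.
  apply: le_trans (normc_prod_sub1 (a := fun m => K * m%:R^-1 ^+ 2) _ _) _.
    by move=> m; exact: GE.
  rewrite lerD2r ler_expR -big_nat -mulr_sumr ler_wpM2l //.
  have n2 : (n <= n.*2)%N by rewrite -addnn leq_addr.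
  by rewrite (le_trans (sum_inv_sqr_le _ n0 n2)) // lerBlDr lerDl invr_ge0.
apply: cvg_expR_sub1; rewrite -(mulr0 K); apply: cvgM; first exact: cvg_cst.
by rewrite -cvg_shiftS; exact: cvg_harmonic.
Qed.

(** The sum is a difference of harmonic numbers, of which the logarithmic parts
    leave [ln (2 n) - ln n]. *)
Lemma cvg_sum_inv_window :
  \sum_(n.+1 <= m < n.*2.+1) m%:R^-1 @[n --> \oo] --> (ln 2 : R).
Proof.
pose x n : R := harm R n - ln n%:R.
have xE : x n @[n --> \oo] --> (euler_gamma : R) := @cvg_euler_gamma R.
have x2E : x n.*2 @[n --> \oo] --> (euler_gamma : R).
  move/cvgrPdist_lt: xE => xE; apply/cvgrPdist_lt => e /xE [N _ HN].
  by exists N => // n /= Nn; apply: HN => /=; rewrite -addnn (leq_trans Nn) // leq_addr.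
have d : x n.*2 - x n + ln 2 @[n --> \oo] --> (ln 2 : R).
  rewrite -[X in _ --> X]add0r -(subrr (euler_gamma : R)).
  exact: (cvgD (cvgB x2E xE) (cvg_cst _)).
have E n : \sum_(n.+2 <= m < n.+1.*2.+1) m%:R^-1 = x n.+1.*2 - x n.+1 + ln 2 :> R.
  have h2 : harm R n.+1.*2 = harm R n.+1 + \sum_(n.+2 <= m < n.+1.*2.+1) m%:R^-1.
    by rewrite /harm (@big_cat_nat _ _ _ n.+2) //=; lia.
  have l2 : ln n.+1.*2%:R = ln n.+1%:R + ln 2 :> R.
    by rewrite -muln2 natrM lnM ?posrE.
  by rewrite /x h2 l2; ring.
rewrite -cvg_shiftS /=; under eq_fun do rewrite E.
by move: d; rewrite -cvg_shiftS.
Qed.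

Lemma cvg_sum_inv_sqr_window :
  n%:R * (\sum_(n.+1 <= m < n.*2.+1) m%:R^-1 ^+ 2) @[n --> \oo] --> (1 / 2 : R).
Proof.
have up n : (0 < n)%N ->
    n%:R * (\sum_(n.+1 <= m < n.*2.+1) m%:R^-1 ^+ 2) <= 1 / 2 :> R.
  move=> n0; have nR : 0 < n%:R :> R by rewrite ltr0n.
  have n2 : (n <= n.*2)%N by rewrite -addnn leq_addr.
  have -> : 1 / 2 = n%:R * (n%:R^-1 - n.*2%:R^-1) :> R.
    by rewrite -muln2 natrM; field; rewrite gt_eqF.
  by rewrite ler_wpM2l // ?sum_inv_sqr_le // ltW.
have lo n : (0 < n)%N ->
    1 / 2 - n%:R^-1 <= n%:R * (\sum_(n.+1 <= m < n.*2.+1) m%:R^-1 ^+ 2) :> R.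
  move=> n0; have nR : 0 < n%:R :> R by rewrite ltr0n.
  have tele M : (n <= M)%N -> n.+1%:R^-1 - M.+1%:R^-1 <=
      \sum_(n.+1 <= m < M.+1) m%:R^-1 ^+ 2 :> R.
    elim: M => [|M IH]; first by rewrite leqn0 => /eqP ->; rewrite big_geq // subrr.
    rewrite leq_eqVlt => /predU1P[<-|nM]; first by rewrite big_geq // subrr.
    rewrite big_nat_recr //=; apply: le_trans (lerD (IH nM) (lexx _)).
    rewrite -addrA lerD2l; have M1 : 0 < M.+1%:R :> R by rewrite ltr0n.
    rewrite -(natr1 M.+1); move: (M.+1%:R) M1 => t t0.
    have t1 : 0 < t + 1 by lra.
    have -> : - (t + 1)^-1 = - t^-1 + t^-1 ^+ 2 - t^-1 ^+ 2 * (t + 1)^-1.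
      by field; rewrite !gt_eqF.
    have : 0 <= t^-1 ^+ 2 * (t + 1)^-1 by rewrite mulr_ge0 ?sqr_ge0 // invr_ge0 ltW.
    lra.
  have n2 : (n <= n.*2)%N by rewrite -addnn leq_addr.
  apply: le_trans (ler_wpM2l (ltW nR) (tele _ n2)).
  rewrite -(natr1 n) -(natr1 n.*2) -muln2 natrM; move: (n%:R) nR => t t0.
  have t1 : 0 < t + 1 by lra.
  have t2 : 0 < t * 2 + 1 by lra.
  have -> : t * ((t + 1)^-1 - (t * 2 + 1)^-1) =
      1 / 2 - t^-1 + (t ^+ 2 + 5 * t + 2) / (2 * t * (t + 1) * (t * 2 + 1)).
    by field; rewrite !gt_eqF.
  rewrite lerDl divr_ge0 //; first by rewrite !addr_ge0 ?sqr_ge0 // mulr_ge0 // ltW.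
  by rewrite !mulr_ge0 // ltW.
apply/cvgrPdist_le => e e0.
have /cvgrPdist_le/(_ e e0)[N _ HN] := @cvg_harmonic R.
exists N.+1 => // -[//|n] /= Nn; have := HN n Nn; rewrite /= sub0r normrN ger0_norm ?invr_ge0 // => ne.
move: (up n.+1 isT) (lo n.+1 isT) ne; set s := _ * \sum_(_ <= _ < _) _; set t := n.+1%:R^-1.
by move=> h1 h2 h3; rewrite ger0_norm; lra.
Qed.

Lemma cvg_window_sum : window_sum n @[n --> \oo] --> (3 / 2 * ln 2 - 1 / 2 : R).
Proof.
have -> : window_sum = fun n => 3 / 2 * (\sum_(n.+1 <= m < n.*2.+1) m%:R^-1)
    - n%:R * (\sum_(n.+1 <= m < n.*2.+1) m%:R^-1 ^+ 2).
  by apply/funext => n; rewrite /window_sum !mulr_sumr -sumrB.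
exact: (cvgB (cvgM (cvg_cst _) cvg_sum_inv_window) cvg_sum_inv_sqr_window).
Qed.

End WindowProduct.

(** * The asymptotics *)

Section Asymptotics.
Variables (R : realType) (beta : R[i]).
Hypothesis bZ : forall m : int, beta != m%:~R.
Hypothesis L0 : forall m, (0 < m)%N -> lfac beta m != 0.

(** The determinant decays like [n ^ - kappa]. *)
Let kappa : R[i] := (3 * beta ^+ 2 + beta) / 2.

Definition barnes_ratio n : R[i] :=
  barnes_prod beta n * barnes_prod (- beta) n * barnes_prod (- (1 / 2) - beta) n
  / barnes_prod (- (1 / 2)) n.

Lemma half_neq_int k : (0 < k)%N -> - (1 / 2) != - k%:R :> R[i].
Proof.
move=> k0; rewrite eqr_opp; apply/eqP => h.
have : (1 : R[i]) = (2 * k)%:R by rewrite natrM -h; field.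
by move/eqP; rewrite (eqr_nat _ 1) => /eqP; lia.
Qed.

(** The linear factors match because
    [lfac beta (2 k - 1) = (1 - (1 / 2 + beta) / k) / (1 - 1 / (2 k))]. The
    exponential factors of the Barnes products contribute [beta + kappa / k]. *)
Lemma barnes_ratioE n :
  \prod_(1 <= k < n.+1)
    ((1 - beta ^+ 2 / k%:R ^+ 2) ^+ k * lfac beta k.*2.-1 ^+ k)
  = barnes_ratio n * expC (- (n%:R * beta) - kappa * (harm R n)%:C).
Proof.
have -> : - (n%:R * beta) - kappa * (harm R n)%:C =
    \sum_(1 <= k < n.+1) (- (beta + kappa / k%:R)).
  rewrite sumrN big_split /= sumr_const_nat subn1 /= -mulr_sumr opprD mulr_natl.
  by congr (_ - _ * _); rewrite /harm rmorph_sum /=; apply: eq_bigr => k _; rewrite fmorphV rmorph_nat.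
rewrite expC_sum /barnes_ratio /barnes_prod -prodfV -!big_split /= !big_nat.
apply: eq_bigr => k /andP[k0 _].
have kC : k%:R != 0 :> R[i] by rewrite pnatr_eq0 -lt0n.
have k2 : 2 * k%:R - 1 != 0 :> R[i].
  have -> : 2 * k%:R - 1 = k.*2.-1%:R :> R[i].
    by rewrite -subn1 natrB -?muln2 ?natrM; [ring|lia].
  by rewrite pnatr_eq0; lia.
pose ex (z : R[i]) := - z + z ^+ 2 / (2 * k%:R).
have eE : - (beta + kappa / k%:R) =
    ex (- (1 / 2)) - ex beta - ex (- beta) - ex (- (1 / 2) - beta).
  by rewrite /ex /kappa; field; rewrite kC.
have lE : lfac beta k.*2.-1 = (1 + (- (1 / 2) - beta) / k%:R) / (1 + - (1 / 2) / k%:R).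
  rewrite /lfac; have -> : k.*2.-1%:R = 2 * k%:R - 1 :> R[i].
    by rewrite -subn1 natrB -?muln2 ?natrM; [ring|lia].
  by field; rewrite k2 kC.
have qE : 1 - beta ^+ 2 / k%:R ^+ 2 = (1 + beta / k%:R) * (1 + - beta / k%:R) by field.
have expCB (z w : R[i]) : expC (z - w) = expC z / expC w by rewrite expCD expCN.
rewrite eE lE qE !expCB -!/(ex _) exprMn expr_div_n.
have h0 : (1 + - (1 / 2) / k%:R) ^+ k != 0 :> R[i].
  have -> : 1 + - (1 / 2) / k%:R = (2 * k%:R - 1) / (2 * k%:R) :> R[i] by field; rewrite kC.
  by rewrite expf_neq0 // mulf_neq0 // invr_eq0 mulf_neq0 // pnatr_eq0.
move: h0 (expC_neq0 (ex (- (1 / 2)))) (expC_neq0 (ex beta)) (expC_neq0 (ex (- beta)))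
  (expC_neq0 (ex (- (1 / 2) - beta))).
move: (expC _) (expC _) (expC _) (expC _) (_ ^+ k) (_ ^+ k) (_ ^+ k) (_ ^+ k).
move=> a b c d e f g h; move=> h0 a0 b0 c0 d0.
by field; rewrite d0 c0 b0 a0 h0.
Qed.

Definition barnes_lim (z : R[i]) : R[i] := limn (barnes_prod z).

Definition barnes_lim_ratio : R[i] :=
  barnes_lim beta * barnes_lim (- beta) * barnes_lim (- (1 / 2) - beta)
  / barnes_lim (- (1 / 2)).

Lemma barnes_lim_half_neq0 : barnes_lim (- (1 / 2)) != 0.
Proof. by apply: barnes_prod_lim_neq0 => k; exact: half_neq_int. Qed.

Lemma cvg_barnes_ratio : barnes_ratio n @[n --> \oo] --> barnes_lim_ratio.
Proof.
have c z : barnes_prod z n @[n --> \oo] --> barnes_lim z := @cvg_barnes_prod R z.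
apply: cvgC_mul (cvgC_mul (cvgC_mul (c _) (c _) erefl) (c _) erefl) _ erefl.
exact: cvgC_inv (c _) barnes_lim_half_neq0.
Qed.

Lemma barnes_lim_ratio_neq0 : barnes_lim_ratio != 0.
Proof.
rewrite /barnes_lim_ratio mulf_neq0 ?invr_eq0 ?barnes_lim_half_neq0 //.
rewrite !mulf_neq0 //; apply: barnes_prod_lim_neq0 => k k0.
- by have := bZ (- k%:Z); rewrite mulrNz.
- by rewrite eqr_opp; exact: (bZ k).
have /L0 : (0 < k.*2.-1)%N by lia.
rewrite lfac_eq0 //; last lia.
apply: contra => /eqP h; have -> : beta = k%:R - 1 / 2 by rewrite -[k%:R]opprK -h; ring.
by rewrite -subn1 natrB -?muln2 ?natrM; [apply/eqP; field|lia].
Qed.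

(** The determinant is [n ^ - kappa] times a product of factors each of which
    has a limit. *)
Lemma cvg_det :
  (\prod_(r < n) det_ratio beta r) * expC (kappa * (ln n%:R)%:C) @[n --> \oo] -->
  barnes_lim_ratio * expC (- (kappa * (euler_gamma : R)%:C)
    + beta ^+ 2 * (3 / 2 * (ln 2 : R)%:C) - 3 / 2 * beta ^+ 2).
Proof.
pose T n := (csinpi beta / beta / sine_prod beta n) ^+ n.
pose W n := window_prod (lfac beta) n * expC (n%:R * beta + beta ^+ 2 * (window_sum R n)%:C).
have -> : (fun n => \prod_(r < n) det_ratio beta r * expC (kappa * (ln n%:R)%:C))
  = fun n => T n * barnes_ratio n * (W n)^-1 * expC (beta ^+ 2 * (window_sum R n)%:C)
      * expC (- kappa * (harm R n - ln n%:R)%:C).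
  apply/funext => n; rewrite (prod_det_ratioE bZ _ L0) barnes_ratioE -/(T n) /W.
  have -> : (harm R n - ln n%:R)%:C = (harm R n)%:C - (ln n%:R)%:C :> R[i].
    by rewrite rmorphB.
  rewrite invfM -expCN; move: (T n) (barnes_ratio n) (window_prod _ _) => t b v.
  move: (harm R n)%:C (ln n%:R)%:C (window_sum R n)%:C => x y z.
  have -> : t * (b * expC (- (n%:R * beta) - kappa * x)) / v * expC (kappa * y)
      = t * b / v * (expC (- (n%:R * beta) - kappa * x) * expC (kappa * y)) by ring.
  rewrite -!(mulrA (t * b)) -!(mulrA v^-1); congr (_ * (_ * _)).
  by rewrite -!expCD; congr expC; ring.
have g : (harm R n - ln n%:R)%:C @[n --> \oo] --> ((euler_gamma : R)%:C : R[i]).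
  exact: cvgC_real (@cvg_euler_gamma R).
have q : (window_sum R n)%:C @[n --> \oo] --> ((3 / 2 * ln 2 - 1 / 2 : R)%:C : R[i]).
  exact: cvgC_real (@cvg_window_sum R).
have Tc : T n @[n --> \oo] --> expC (- beta ^+ 2).
  exact: cvg_sine_tail (sine_factors_neq0 bZ) (cvg_sine_prod_csinpi bZ).
have Wc : (W n)^-1 @[n --> \oo] --> (1^-1 : R[i]).
  exact: cvgC_inv (@cvg_window_prod R beta) (oner_neq0 _).
have Ec := cvg_expC (cvgC_mul (@cvgC_cst R (beta ^+ 2)) q erefl).
have Gc := cvg_expC (cvgC_mul (@cvgC_cst R (- kappa)) g erefl).
apply: (cvgC_mul (cvgC_mul (cvgC_mul (cvgC_mul Tc cvg_barnes_ratio erefl) Wc erefl) Ec erefl) Gc).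
have comm (a b c d : R[i]) : a * b * c * d = b * (a * c * d) by ring.
rewrite invr1 mulr1 comm -!expCD; congr (_ * expC _).
have -> : (3 / 2 * ln 2 - 1 / 2)%:C = 3 / 2 * (ln 2 : R)%:C - 1 / 2 :> R[i].
  by rewrite !(rmorphB, fmorph_div, rmorph1, rmorph_nat, rmorphM).
move: (ln 2)%:C (euler_gamma)%:C => l g'.
by field.
Qed.

End Asymptotics.

(** * The theorem *)

Lemma barnesG1E (R : realType) (z : R[i]) :
  barnesG1 z = expC (z / 2 * (ln (2 * pi))%:C
    + (- ((z + 1) * z / 2) - euler_gamma%:C * z ^+ 2 / 2)) * barnes_lim z.
Proof. by rewrite expCD. Qed.

(** The four arguments [z] of [barnesG1], counted with sign, have sum [- beta] and
    sum of squares [3 beta ^ 2 + beta]: the former cancels the power of [2 pi], the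
    latter gives the coefficient of Euler's constant. *)
Lemma barnes_constant (R : realType) (beta : R[i]) :
  cpow (2 * pi : R) (beta / 2) * cpow (2 : R) (3 * beta ^+ 2 / 2)
    * (barnesG (1 / 2))^-1
    * barnesG (1 / 2 - beta) * barnesG (1 - beta) * barnesG (1 + beta)
  = barnes_lim_ratio beta * expC (- ((3 * beta ^+ 2 + beta) / 2 * (euler_gamma : R)%:C)
    + beta ^+ 2 * (3 / 2 * (ln 2 : R)%:C) - 3 / 2 * beta ^+ 2).
Proof.
rewrite /barnesG.
have -> : 1 / 2 - 1 = - (1 / 2) :> R[i] by field.
have -> : 1 / 2 - beta - 1 = - (1 / 2) - beta by field.
have -> : 1 - beta - 1 = - beta by ring.
have -> : 1 + beta - 1 = beta by ring.
rewrite !barnesG1E /cpow /barnes_lim_ratio invfM -expCN.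
move: (barnes_lim _) (barnes_lim _) (barnes_lim _) (barnes_lim _) => p q r s.
have comm (a b c d e f g x y z : R[i]) :
    a * b * (c * x) * (d * y) * (e * z) * (f * g) = g * z * y * x * (a * b * c * d * e * f).
  by ring.
rewrite comm -!expCD; congr (_ * expC _).
move: (ln (2 * pi))%:C (ln 2)%:C (euler_gamma)%:C => l m g.
by field.
Qed.

Theorem theorem6p2 (R : realType) (beta : R[i]) (phi : R[i] -> R[i])
    (hbeta : forall m : int, beta <> m%:~R) (hphi : is_t_symbol beta phi) :
  asymp_equiv (fun n : nat => \det (toeplitz_hankel n phi))
    (fun n : nat =>
       cpow (n%:R : R) (- (3 * beta ^+ 2 / 2) - beta / 2)
       * cpow (2 * pi : R) (beta / 2)
       * cpow (2 : R) (3 * beta ^+ 2 / 2)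
       * (barnesG (1 / 2))^-1
       * barnesG (1 / 2 - beta) * barnesG (1 - beta) * barnesG (1 + beta))
  /\
  (forall n : nat,
     \det (toeplitz_hankel n phi) = 0 <->
     exists2 j : nat, (j < n)%N & beta = j%:R + 1 / 2).
Proof.
have bZ (m : int) : beta != m%:~R by apply/eqP/hbeta.
split; last by move=> n; rewrite (det_toeplitz_hankel n hphi bZ); exact: prod_det_ratio_eq0.
have [[m [m0 /(lfac_eq0_half bZ m0)[j _ bj]]]|L0] :
    (exists m, (0 < m)%N /\ lfac beta m = 0) \/ (forall m, (0 < m)%N -> lfac beta m != 0).
  have [h|h] := pselect (exists m, (0 < m)%N /\ lfac beta m = 0); first by left.
  by right=> m m0; apply/eqP => lm; apply: h; exists m.
  (* If beta is a half-integer, G (1 / 2 - beta) vanishes as well. *)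
  exists (fun=> 0); first exact: cvgC_cst.
  exists j.+1 => // n /= jn.
  have -> : barnesG (1 / 2 - beta) = 0.
    rewrite /barnesG barnesG1E (_ : 1 / 2 - beta - 1 = - j.+1%:R).
      by rewrite /barnes_lim barnes_prod_lim_eq0 mulr0.
    by rewrite bj -(natr1 j); ring.
  rewrite mulr0 !mul0r (det_toeplitz_hankel n hphi bZ).
  by apply/(prod_det_ratio_eq0 bZ); exists j.
pose kappa : R[i] := (3 * beta ^+ 2 + beta) / 2.
pose D n := \det (toeplitz_hankel n phi).
have DE n : D n = \prod_(r < n) det_ratio beta r := det_toeplitz_hankel n hphi bZ.
set c := (X in asymp_equiv _ X).
pose l : R[i] := barnes_lim_ratio beta * expC (- (kappa * (euler_gamma : R)%:C)
    + beta ^+ 2 * (3 / 2 * (ln 2 : R)%:C) - 3 / 2 * beta ^+ 2).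
have l0 : l != 0 by rewrite mulf_neq0 ?expC_neq0 ?barnes_lim_ratio_neq0.
have cE n : c n = expC (- (kappa * (ln n%:R)%:C)) * l.
  have -> : expC (- (kappa * (ln n%:R)%:C)) = cpow n%:R (- (3 * beta ^+ 2 / 2) - beta / 2).
    by rewrite /cpow /kappa; congr expC; move: (ln n%:R)%:C => x; field.
  by rewrite /c /l -barnes_constant !mulrA.
exists (fun n => D n * expC (kappa * (ln n%:R)%:C) * l^-1 - 1).
  have -> : (0 : R[i]) = l * l^-1 - 1 by rewrite divff // subrr.
  apply: cvgC_sub (@cvgC_cst R 1); apply: cvgC_mul (@cvgC_cst R l^-1) erefl.
  have -> : D = fun n => \prod_(r < n) det_ratio beta r by apply/funext.
  exact: cvg_det.
exists 0%N => // n _; rewrite -/(D n) cE expCN addrC subrK.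
have := expC_neq0 (kappa * (ln n%:R)%:C); move: (expC _) l0 => x l0 x0; field.
by rewrite x0 l0.
Qed.
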